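(* Let $\nu$ be an offspring distribution with $\nu_1=0$, let $n\ge 2$ be such that a Galton-Watson tree with offspring distribution $\nu$ has exactly $n$ leaves with positive probability, and let $\mathcal{G}^{(n)}$ be such a Galton-Watson tree conditioned to have $n$ leaves. Let $\widehat{\mathcal{G}}^{(n)}$ be the tree obtained from $\mathcal{G}^{(n)}$ by adding to every branch point with $k$ children $k-2$ further children without offspring. Then there is a coupling of the random cut-trees ${\rm cut}_{\rm D}(\widehat{\mathcal{G}}^{(n)})$ and ${\rm cut}_{\rm HW}(\mathcal{G}^{(n)})$ such that $$d_{\rm GH}\left({\rm cut}_{\rm D}(\widehat{\mathcal{G}}^{(n)}),{\rm cut}_{\rm HW}(\mathcal{G}^{(n)})\right)\le 1 .$$
   Context: **Trees.** A rooted planar tree $\mathbf{t}$ has a finite vertex set $V(\mathbf{t})$, a root $\rho$, and for each vertex $v$ a totally ordered set of $k_v(\mathbf{t})$ children; an edge $w\rightarrow v$ joins a child $w$ to its parent $v$. Leaves are vertices with no children; branch points are non-leaf vertices. Trees have $k_v\neq 1$ for all $v$. Discrete trees are pointed metric spaces with the graph distance, pointed at the root. **${\rm cut}_{\rm HW}(\mathbf{t})$.** Start from the single component $V(\mathbf{t})$. A component (viewed as a tree) with $m\ge 2$ leaves is split as follows: select one of its branch points $v$ with probability $(k_v-1)/(m-1)$, where $k_v$ is its number of children, and remove the edges $w\rightarrow v$ from all children $w$ of $v$; this yields $k_v+1$ components (the component of the root of the split component, in which $v$ is now a leaf, and the $k_v$ components rooted at the children of $v$). Splits are performed independently and repeatedly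 until all components are singletons. The tree ${\rm cut}^\circ_{\rm HW}(\mathbf{t})$ has as vertices all components that ever exist, as root the component $V(\mathbf{t})$, and the children of a component are the components into which it is split. ${\rm cut}_{\rm HW}(\mathbf{t})$ is obtained by adding, for every split at a branch point with $k$ children, $k-2$ further leaf children to the component that is split. **${\rm cut}_{\rm D}(\mathbf{t})$** (Dieuleveut's vertex cut-tree). Start from the single component consisting of all edges of $\mathbf{t}$. A component with $m\ge 2$ edges is split as follows: select a vertex $v$ with probability $k_v/m$, where $k_v$ is the number of edges of the component from children of $v$ to $v$; remove these $k_v$ edges, each of which becomes a singleton component (never split again), and the remaining edges form the further (non-empty) connected components: the part below $v$ and the parts above each of the children of $v$. Splits are independent and repeated until all components are singletons. ${\rm cut}_{\rm D}(\mathbf{t})$ has as vertices all edge-components that ever exist, as root the initial component, and the children of a component are its fragments. **GH distance.** For compact pointed metric spaces, $d_{\rm GH}((T,d,\rho),(T',d',\rho'))=\inf\{d_{\rm H}^Z(\Phi(T),\Phi'(T'))+d^Z(\Phi(\rho),\Phi'(\rho'))\}$, the infimum being over all isometric embeddings $\Phi,\Phi'$ into a common Polish metric space $(Z,d^Z)$, with $d_{\rm H}^Z$ the Hausdorff distance. *)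

(* Defs.v *)
From HB Require Import structures.
From mathcomp Require Import all_boot all_order all_algebra finmap.
From mathcomp Require Import all_classical all_reals all_analysis.

Set Implicit Arguments.
Unset Strict Implicit.
Unset Printing Implicit Defensive.

Import Order.TTheory GRing.Theory Num.Theory.
Import numFieldNormedType.Exports.

Local Open Scope classical_set_scope.
Local Open Scope ring_scope.

(* Finite rooted planar trees whose vertices carry labels in A. *)
Inductive rtree (A : Type) : Type := RNode of A & seq (rtree A).

Definition tree := rtree unit.

Definition tnode (s : seq tree) : tree := RNode tt s.

Definition label A (t : rtree A) : A := let: RNode a _ := t in a.

Section RtreeStructures.
Context {A : Type}.

Lemma rtree_ind_forall (P : rtree A -> Prop) :
  (forall a s, foldr (fun t Q => P t /\ Q) True s -> P (RNode a s)) ->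
  forall t, P t.
Proof.
move=> PN; fix IH 1 => -[a s]; apply: PN.
elim: s => [|t s IHs]; first by [].
by split; [exact: IH|exact: IHs].
Qed.

Fixpoint rtree_encode (t : rtree A) : GenTree.tree A :=
  let: RNode a s := t in GenTree.Node 0 (GenTree.Leaf a :: map rtree_encode s).

Fixpoint rtree_decode (g : GenTree.tree A) : option (rtree A) :=
  match g with
  | GenTree.Node _ (GenTree.Leaf a :: s) =>
      Some (RNode a (pmap id (map rtree_decode s)))
  | _ => None
  end.

Lemma rtree_encodeK : pcancel rtree_encode rtree_decode.
Proof.
elim/rtree_ind_forall => a s /= IH; congr (Some (RNode a _)).
by elim: s IH => [|t s IHs] //= [-> /IHs ->].
Qed.

End RtreeStructures.

HB.instance Definition _ (A : choiceType) :=
  Choice.copy (rtree A) (pcan_type (@rtree_encodeK A)).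

HB.instance Definition _ (A : countType) :=
  Countable.copy (rtree A) (pcan_type (@rtree_encodeK A)).

HB.instance Definition _ (A : pointedType) :=
  isPointed.Build (rtree A) (RNode point [::]).

(* Ulam-Harris coding: the i-th child (from 0) of the vertex v is rcons v i. *)
Definition addr : Type := seq nat.

Fixpoint vertices A (t : rtree A) : seq addr :=
  let: RNode _ s := t in
  [::] :: flatten [seq [seq p.1 :: v | v <- p.2]
                  | p <- zip (iota 0 (size s)) (map (@vertices A) s)].

(* w is a child of v, i.e. w -> v is an edge. *)
Definition child_of (v w : addr) : bool := w == rcons v (last 0%N w).

Fixpoint nleaves A (t : rtree A) : nat :=
  let: RNode _ s := t in
  if s is [::] then 1%N else sumn (map (@nleaves A) s).

Definition vertex A (t : rtree A) : finType := seq_sub (vertices t).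

Lemma root_in_vertices A (t : rtree A) : [::] \in vertices t.
Proof. by case: t => a s; rewrite inE eqxx. Qed.

Definition root A (t : rtree A) : vertex t := SeqSub (root_in_vertices t).

Definition adjacent A (t : rtree A) : rel (vertex t) :=
  [rel u v | child_of (val u) (val v) || child_of (val v) (val u)].

Lemma adjacent_sym A (t : rtree A) : symmetric (@adjacent A t).
Proof. by move=> u v; rewrite /adjacent /= orbC. Qed.

Lemma mem_vertices_cons A (a : A) s i (v : addr) :
  (i :: v \in vertices (RNode a s)) =
  (i < size s)%N && (v \in vertices (nth (RNode a [::]) s i)).
Proof.
rewrite /= in_cons /=; apply/flattenP/andP.
  case=> _ /mapP[[j l] /(nthP (0%N, [::])) [k +] + ->] /mapP[x xl [-> ->]].
  rewrite size_zip size_iota size_map minnn => ks.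
  rewrite nth_zip ?size_iota ?size_map// nth_iota// add0n => -[<- le].
  by split=> //; rewrite -(nth_map _ [::])// le.
case=> si vi; exists [seq i :: w | w <- vertices (nth (RNode a [::]) s i)].
  apply/mapP; exists (i, vertices (nth (RNode a [::]) s i)) => //.
  apply/(nthP (0%N, [::])); exists i.
    by rewrite size_zip size_iota size_map minnn.
  by rewrite nth_zip ?size_iota ?size_map// nth_iota// add0n (nth_map (RNode a [::])).
by apply/mapP; exists v.
Qed.

Lemma mem_vertices_rcons A (t : rtree A) (v : addr) i :
  rcons v i \in vertices t -> v \in vertices t.
Proof.
elim: v t => [|j v IH] t; first by rewrite root_in_vertices.
case: t => a s; rewrite rcons_cons !mem_vertices_cons => /andP[-> /=].
exact: IH.
Qed.

Lemma connect_root A (t : rtree A) (v : vertex t) : connect (@adjacent A t) (root t) v.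
Proof.
case: v => v; elim/last_ind: v => [|v i IH] vt.
  by rewrite (_ : root t = SeqSub vt) ?connect0//; exact: val_inj.
have vt' := mem_vertices_rcons vt.
apply: connect_trans (IH vt') (connect1 _).
by rewrite /adjacent /= /child_of last_rcons eqxx.
Qed.

Section GraphDistance.
Context {A : Type} (t : rtree A).
Implicit Types u v w : vertex t.

Definition joined_by u v (n : nat) : bool :=
  [exists p : n.-tuple (vertex t), path (@adjacent A t) u p && (last u p == v)].

Lemma joined_byP u v n :
  reflect (exists p, [/\ path (@adjacent A t) u p, last u p = v & size p = n])
          (joined_by u v n).
Proof.
apply: (iffP existsP) => [[p /andP[pu /eqP pv]]|[p [pu pv pn]]].
  by exists p; rewrite size_tuple.
have pn' : size p == n by apply/eqP.
by exists (Tuple pn'); rewrite /= pu pv eqxx.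
Qed.

Lemma ex_joined_by u v : exists n, joined_by u v n.
Proof.
have /connectP[p pu pv] : connect (@adjacent A t) u v.
  apply: connect_trans (connect_root v).
  by rewrite (sym_connect_sym (@adjacent_sym A t)) connect_root.
by exists (size p); apply/joined_byP; exists p.
Qed.

Definition graph_dist u v : nat := ex_minn (ex_joined_by u v).

Lemma graph_dist_path u v : joined_by u v (graph_dist u v).
Proof. by rewrite /graph_dist; case: ex_minnP. Qed.

Lemma graph_dist_le u v n : joined_by u v n -> (graph_dist u v <= n)%N.
Proof. by rewrite /graph_dist; case: ex_minnP => m _; apply. Qed.

Lemma graph_distxx u : graph_dist u u = 0%N.
Proof.
by apply/eqP; rewrite -leqn0; apply/graph_dist_le/joined_byP; exists [::].
Qed.

Lemma graph_dist_eq0 u v : graph_dist u v = 0%N -> u = v.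
Proof.
move=> uv; have := graph_dist_path u v.
by rewrite uv => /joined_byP[p [_ <- /size0nil ->]].
Qed.

Lemma graph_dist_leC u v : (graph_dist u v <= graph_dist v u)%N.
Proof.
have /joined_byP[p [pv pu <-]] := graph_dist_path v u.
apply/graph_dist_le/joined_byP; exists (rev (belast v p)); split.
- rewrite -pu rev_path (eq_path (e' := @adjacent A t))// => x y.
  exact: adjacent_sym.
- by rewrite -pu; case: (p) => //= x q; rewrite rev_cons last_rcons.
- by rewrite size_rev size_belast.
Qed.

Lemma graph_distC u v : graph_dist u v = graph_dist v u.
Proof. by apply/eqP; rewrite eqn_leq !graph_dist_leC. Qed.

Lemma graph_dist_triangle v u w :
  (graph_dist u w <= graph_dist u v + graph_dist v w)%N.
Proof.
have /joined_byP[p [pu pv <-]] := graph_dist_path u v.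
have /joined_byP[q [qv qw <-]] := graph_dist_path v w.
apply/graph_dist_le/joined_byP; exists (p ++ q).
by rewrite cat_path pu pv qv last_cat pv qw size_cat.
Qed.

End GraphDistance.

(* The vertex set of t as a metric space over R. *)
Definition tree_space (R : realType) A (t : rtree A) : Type := vertex t.

Section TreeSpace.
Context {R : realType} {A : Type} (t : rtree A).

HB.instance Definition _ := Choice.copy (tree_space R t) (vertex t).

Let dist (u v : tree_space R t) : R := (graph_dist u v)%:R.

Let distxx u : dist u u = 0.
Proof. by rewrite /dist graph_distxx. Qed.

Let dist_eq0 u v : dist u v = 0 -> u = v.
Proof. by move/eqP; rewrite pnatr_eq0 => /eqP/graph_dist_eq0. Qed.

Let distC u v : dist u v = dist v u.
Proof. by rewrite /dist graph_distC. Qed.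

Let dist_triangle v u w : dist u w <= dist u v + dist v w.
Proof. by rewrite /dist -natrD ler_nat graph_dist_triangle. Qed.

HB.instance Definition _ :=
  isMetric.Build R (tree_space R t) distxx dist_eq0 distC dist_triangle.

End TreeSpace.

Lemma mdist_tree (R : realType) A (t : rtree A) (u v : tree_space R t) :
  mdist u v = (graph_dist u v)%:R.
Proof. by []. Qed.

Section GromovHausdorff.
Context {R : realType}.
Local Open Scope ereal_scope.

Definition polish (Z : metricType R) : Prop :=
  (forall F : set_system Z, ProperFilter F -> cauchy F -> exists z : Z, F --> z) /\
  exists2 D : set Z, countable D & dense D.

Definition isometric (X Z : metricType R) (f : X -> Z) : Prop :=
  forall x y, mdist (f x) (f y) = mdist x y.

Definition hausdorff_dist (Z : metricType R) (A B : set Z) : \bar R :=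
  maxe (ereal_sup [set ereal_inf [set (mdist a b)%:E | b in B] | a in A])
       (ereal_sup [set ereal_inf [set (mdist a b)%:E | a in A] | b in B]).

Definition GH_dist (X Y : metricType R) (x0 : X) (y0 : Y) : \bar R :=
  ereal_inf [set r | exists (Z : metricType R) (f : X -> Z) (g : Y -> Z),
    [/\ polish Z, isometric f, isometric g &
        r = hausdorff_dist (range f) (range g) + (mdist (f x0) (g y0))%:E]].

Definition tree_GH_dist A B (s : rtree A) (t : rtree B) : \bar R :=
  GH_dist (root s : tree_space R s) (root t : tree_space R t).

End GromovHausdorff.

Section GaltonWatson.
Context {R : realType} (nu : probability nat R).

(* The probability that the Galton-Watson tree equals the finite tree t. *)
Fixpoint gw_prob (t : tree) : R :=
  let: RNode _ s := t in
  fine (nu [set size s]) * \prod_(p <- map gw_prob s) p.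

(* The probability of having n leaves.  Infinite trees may be left out: for
   n > 0, almost surely they do not have exactly n leaves. *)
Definition gw_nleaves_prob (n : nat) : \bar R :=
  (\esum_(t in [set t : tree | nleaves t = n]) (gw_prob t)%:E)%E.

Definition gw_cond_prob (n : nat) (t : tree) : R :=
  if nleaves t == n then gw_prob t / fine (gw_nleaves_prob n) else 0.

End GaltonWatson.

Fixpoint add_leaves (t : tree) : tree :=
  let: RNode _ s := t in
  tnode (map add_leaves s ++ nseq (size s - 2) (tnode [::])).

Definition component : Type := {fset addr}.

(* A vertex of a cut-tree is labelled by the component it stands for.  The
   fragments of a component are listed in an arbitrary fixed order. *)
Definition cut_tree : Type := rtree component.

HB.instance Definition _ := Countable.on cut_tree.
HB.instance Definition _ := Pointed.on cut_tree.

HB.instance Definition _ := @isMeasurable.Build default_measure_display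
  cut_tree (@discrete_measurable cut_tree) (@discrete_measurable0 _)
  (@discrete_measurableC _) (@discrete_measurableU _).

Local Open Scope fset_scope.

Definition vertex_set (t : tree) : component := [fset v | v in vertices t].

(* Edges are coded by their upper endpoints: w stands for w -> v, with v the
   parent of w. *)
Definition edge_set (t : tree) : component := vertex_set t `\ [::].

Definition children (C : component) (v : addr) : component :=
  [fset w in C | child_of v w].

(* Vertices (resp. edges) of C in the subtree above v, v included. *)
Definition above (v : addr) (C : component) : component :=
  [fset u in C | prefix v u].

Definition strictly_above (v : addr) (C : component) : component :=
  above v C `\ v.

Definition comp_leaves (C : component) : component :=
  [fset v in C | children C v == fset0].

Definition comp_branch_points (C : component) : component :=
  C `\` comp_leaves C.

Definition HW_fragments (C : component) (v : addr) : seq component :=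
  (C `\` strictly_above v C) :: [seq above w C | w <- children C v].

Definition D_fragments (E : component) (v : addr) : seq component :=
  [seq [fset w] | w <- children E v] ++
  [seq F <- (E `\` strictly_above v E)
              :: [seq strictly_above w E | w <- children E v] | F != fset0].

(* Vertices with a child edge in E. *)
Definition lower_endpoints (E : component) : component :=
  [fset take (size w).-1 w | w in E].

Section CutTrees.
Context {R : realType}.

(* The probability that the fragmentation started from the component label c
   yields the cut-tree c: a product over the independent splits in c. *)
Fixpoint HW_split_prob (c : cut_tree) : R :=
  let: RNode C s := c in
  let m := #|` comp_leaves C| in
  if (m < 2)%N then (s == [::])%:R
  else (\sum_(v <- comp_branch_points C | map (@label _) s == HW_fragments C v)
          (#|` children C v|%:R - 1) / (m%:R - 1))
       * \prod_(p <- map HW_split_prob s) p.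

Fixpoint D_split_prob (c : cut_tree) : R :=
  let: RNode E s := c in
  let m := #|` E| in
  if (m < 2)%N then (s == [::])%:R
  else (\sum_(v <- lower_endpoints E | map (@label _) s == D_fragments E v)
          #|` children E v|%:R / m%:R)
       * \prod_(p <- map D_split_prob s) p.

(* The law of the tree of components, without the further leaf children that
   cut_HW_of adds. *)
Definition cut_HW0_prob (t : tree) (c : cut_tree) : R :=
  if label c == vertex_set t then HW_split_prob c else 0.

Definition cut_D_prob (t : tree) (c : cut_tree) : R :=
  if label c == edge_set t then D_split_prob c else 0.

(* The law of a random cut-tree which, given that the conditioned
   Galton-Watson tree is t, has law K t. *)
Definition gw_cut_prob (nu : probability nat R) (n : nat)
    (K : tree -> cut_tree -> R) (c : cut_tree) : \bar R :=
  (\esum_(t in [set: tree]) (gw_cond_prob nu n t * K t c)%:E)%E.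

End CutTrees.

(* A component split at a branch point with k children has k + 1 fragments, so
   that size s - 3 = k - 2; the label None marks the added vertices. *)
Fixpoint cut_HW_of (c : cut_tree) : rtree (option component) :=
  let: RNode C s := c in
  RNode (Some C) (map cut_HW_of s ++ nseq (size s - 3) (RNode None [::])).

(* Main.v *)
From HB Require Import structures.
Require Import Defs.
From mathcomp Require Import all_boot all_order all_algebra finmap.
From mathcomp Require Import all_classical all_reals all_analysis.
From mathcomp Require Import zify.

Set Implicit Arguments.
Unset Strict Implicit.
Unset Printing Implicit Defensive.

Import Order.TTheory GRing.Theory Num.Theory.
Import numFieldNormedType.Exports.

Local Open Scope classical_set_scope.
Local Open Scope ring_scope.

(* If the component C of the first fragmentation has m leaves, then after adding
   leaves the corresponding component of edges, [doubled C], has 2(m - 1) edges,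
   2(k - 1) of them above a branch point with k children; so both fragmentations
   select a given vertex with probability (k - 1)/(m - 1), and the non-singleton
   fragments correspond again.  Hence cut_D is a deterministic injective image
   [D_tree_of] of cut_HW, with the same probabilities; as both laws have total
   mass 1 this is a coupling.  The two cut-trees then differ, up to the order of
   children, only by leaves attached to common internal vertices, so both embed
   into the tree of all finite words, with equal roots and Hausdorff distance at
   most 1. *)

(** * Pointed Gromov-Hausdorff distance of trees *)

(** Components keep the addresses of the original tree, so in a cut-tree of non-zero probability the
    labels of the children of a split component determine the split vertex, and the probability is a
    product with one factor per split. Finite sets are enumerated in an uncontrolled order, which is
    why subtrees are matched by label and never by position. The leaves that differ are, on one
    side, the 2k - 2 removed edges and, on the other, the fragments that are single vertices, which
    have no edge and vanish under [doubled], together with the k - 2 added leaves. Since 2(m - 1) is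
    never 1, no other fragment of the edge process is a singleton, and both processes stop together.
    Comparing total masses spares a description of the image of [D_tree_of]; it rests on the
    termination of both fragmentations. *)

Section AddressDistance.
Local Open Scope nat_scope.
Implicit Types u v w : addr.

(** Path length in the tree of all words: once the common prefix is stripped, the path descends one
    remainder and climbs the other. *)
Fixpoint tdist u v : nat :=
  match u, v with
  | i :: u', j :: v' => if i == j then tdist u' v' else (size u + size v)
  | _, _ => size u + size v
  end.

Lemma tdist0l v : tdist [::] v = size v.
Proof. by []. Qed.

Lemma tdist0r v : tdist v [::] = size v.
Proof. by case: v => //= i v; rewrite addn0. Qed.

Lemma tdistxx u : tdist u u = 0.
Proof. by elim: u => //= i u ->; rewrite eqxx. Qed.

Lemma tdist_eq0 u v : tdist u v = 0 -> u = v.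
Proof.
elim: u v => [|i u IH] [|j v] //=.
by case: (eqVneq i j) => [-> /IH ->|_].
Qed.

Lemma tdistC u v : tdist u v = tdist v u.
Proof.
elim: u v => [|i u IH] [|j v] //=; rewrite ?addn0 ?add0n //.
by rewrite eq_sym IH addnC.
Qed.

Lemma tdist_le u v : tdist u v <= size u + size v.
Proof.
elim: u v => [|i u IH] [|j v] //=.
by case: (eqVneq i j) => // _; have := IH v; lia.
Qed.

Lemma size_le_tdist u v : size u <= tdist u v + size v.
Proof.
elim: u v => [|i u IH] [|j v] //=; first by rewrite !addn0.
case: (eqVneq i j) => _; last by rewrite -addnA leq_addr.
by rewrite addnS ltnS.
Qed.

(** Induction on the middle word: a first letter common to all three words is stripped; otherwise
    one of the two paths on the right passes through the root, and comparing lengths suffices. *)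
Lemma tdist_triangle v u w : tdist u w <= tdist u v + tdist v w.
Proof.
elim: v u w => [|j v IH] u w.
  by rewrite tdist0r tdist0l tdist_le.
case: u => [|i u].
  by rewrite !tdist0l [tdist _ w]tdistC; have := size_le_tdist w (j :: v); lia.
case: w => [|k w].
  by rewrite !tdist0r; exact: size_le_tdist.
have E a b x y : tdist (a :: x) (b :: y) =
    if a == b then tdist x y else (size x + size y).+2.
  by rewrite /= addSn addnS.
rewrite !E; have := (tdist_le u w, size_le_tdist u v, size_le_tdist w v).
rewrite (tdistC w v) => -[[uw uv] wv].
have [ij|ij] := eqVneq i j; have [jk|jk] := eqVneq j k.
- by rewrite ij jk eqxx; exact: IH.
- by rewrite ij (negbTE jk); lia.
- by rewrite -jk (negbTE ij); lia.
- by case: ifP => _; lia.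
Qed.

Lemma tdist_rcons u i : tdist (rcons u i) u = 1.
Proof. by elim: u => //= j u ->; rewrite eqxx. Qed.

(** A path that does not end above [rcons u i] must leave it through its parent [u]. *)
Lemma tdist_rcons_nprefix u i v :
  ~~ prefix (rcons u i) v -> tdist (rcons u i) v = (tdist u v).+1.
Proof.
elim: u v => [|k u IH] [|j v] //=; rewrite ?size_rcons ?addn0 //.
  by rewrite prefix0s andbT => /negbTE ->; rewrite !add1n.
have [_|_ _] := eqVneq k j; first exact: IH.
by rewrite !addSn.
Qed.

(** Neighbours are at word distance 1, so the triangle inequality bounds the length of any path from
    below. Conversely, of two distinct words one is not a prefix of the other; moving it to its
    parent, which stays in [t], brings it one step closer. *)
Lemma graph_distE A (t : rtree A) (u v : vertex t) :
  graph_dist u v = tdist (val u) (val v).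
Proof.
apply/eqP; rewrite eqn_leq; apply/andP; split; last first.
  have /joined_byP[p [pu <- <-]] := graph_dist_path u v.
  elim: p u pu => [|w p IH] u /=; first by rewrite tdistxx.
  case/andP=> uw /IH wp.
  have uw1 : tdist (val u) (val w) = 1.
    case/orP: uw => /eqP ->; last by rewrite tdist_rcons.
    by rewrite tdistC tdist_rcons.
  apply: leq_trans (tdist_triangle (val w) _ _) _.
  by rewrite uw1 add1n ltnS.
have [k] := ubnP (size (val u) + size (val v)).
elim: k u v => // k IH u v uvk.
wlog : u v uvk / ~~ prefix (val u) (val v) => [wl|].
  have [uv|] := boolP (prefix (val u) (val v)); last exact: wl.
  have [vu|] := boolP (prefix (val v) (val u)).
    have -> : u = v.
      by move: uv; rewrite prefixE take_oversize ?size_prefix// => /eqP/val_inj.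
    by rewrite graph_distxx.
  by rewrite graph_distC tdistC; apply: wl; rewrite addnC.
case: u uvk => u ut uvk /=; case/lastP: u ut uvk => [|u i] ut uvk uv.
  by rewrite prefix0s in uv.
have ut' := mem_vertices_rcons ut.
apply: leq_trans (graph_dist_triangle (SeqSub ut') _ _) _.
rewrite tdist_rcons_nprefix // -add1n leq_add //.
  apply: graph_dist_le; apply/joined_byP; exists [:: SeqSub ut']; split=> //=.
  by rewrite andbT /Defs.adjacent /= /child_of last_rcons eqxx orbT.
by apply: IH; move: uvk; rewrite /= size_rcons; lia.
Qed.

End AddressDistance.

(** * The tree of all words as an ambient Polish space *)

Definition addr_space (R : realType) : Type := addr.

Section AddrSpace.
Context {R : realType}.

HB.instance Definition _ := Choice.copy (addr_space R) addr.

Let dist (u v : addr_space R) : R := (tdist u v)%:R.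

Let distxx u : dist u u = 0.
Proof. by rewrite /dist tdistxx. Qed.

Let dist_eq0 u v : dist u v = 0 -> u = v.
Proof. by move/eqP; rewrite pnatr_eq0 => /eqP/tdist_eq0. Qed.

Let distC u v : dist u v = dist v u.
Proof. by rewrite /dist tdistC. Qed.

Let dist_triangle v u w : dist u w <= dist u v + dist v w.
Proof. by rewrite /dist -natrD ler_nat tdist_triangle. Qed.

HB.instance Definition _ :=
  isMetric.Build R (addr_space R) distxx dist_eq0 distC dist_triangle.

End AddrSpace.

Lemma mdist_addr (R : realType) (u v : addr_space R) :
  mdist u v = (tdist u v)%:R.
Proof. by []. Qed.

(** Distances are integers, so balls of radius 1 are points and a Cauchy filter contains a
    singleton; the space is countable. *)
Lemma addr_space_polish (R : realType) : polish (addr_space R).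
Proof.
split.
  move=> F FF /cauchyP /(_ 1 ltr01) [x Fx]; exists x => A /nbhs_singleton Ax.
  apply: filterS Fx => y.
  rewrite ballEmdist /= mdist_addr ltrn1 ltnS leqn0 => /eqP xy.
  by rewrite -(tdist_eq0 xy).
by exists setT; [exact: countableP|move=> O [x Ox] _; exists x].
Qed.

(* [f] maps [s] isometrically to the tree of all words, in which [t] sits by
   inclusion. *)
Definition embeds A B (s : rtree A) (t : rtree B) : Prop :=
  exists f : addr -> addr,
    [/\ f [::] = [::],
        {in vertices s &, forall u v, tdist (f u) (f v) = tdist u v},
        {in vertices s, forall u, exists2 v, v \in vertices t & (tdist (f u) v <= 1)%N} &
        {in vertices t, forall v, exists2 u, u \in vertices s & (tdist (f u) v <= 1)%N}].

(** With the words as common space the roots coincide, so only the Hausdorff distance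
    contributes. *)
Lemma embeds_GH_dist (R : realType) A B (s : rtree A) (t : rtree B) :
  embeds s t -> (tree_GH_dist s t <= 1%:E :> \bar R)%E.
Proof.
move=> [f [f0 f_isom f_st f_ts]].
pose g (x : tree_space R s) : addr_space R := f (val (x : vertex s)).
pose h (y : tree_space R t) : addr_space R := val (y : vertex t).
suff : (hausdorff_dist (range g) (range h)
    + (mdist (g (Defs.root s)) (h (Defs.root t)))%:E <= 1%:E)%E.
  apply: le_trans.
  apply: ereal_inf_lbound; exists (addr_space R), g, h; split=> //.
  - exact: addr_space_polish.
  - by move=> x y; rewrite mdist_addr mdist_tree graph_distE f_isom //; exact: valP.
  - by move=> x y; rewrite mdist_addr mdist_tree graph_distE.
rewrite mdist_addr /g /h /= f0 tdistxx adde0 /hausdorff_dist ge_max.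
apply/andP; split; apply: ge_ereal_sup => _ [_ [x _ <-] <-].
  have [v vt fv] := f_st _ (valP (x : vertex s)).
  apply: ge_ereal_inf; exists (tdist (g x) v)%:R%:E; last first.
    by rewrite lee_fin -[leRHS]/1%:R ler_nat.
  by exists v => //; exists (SeqSub vt).
have [u us fu] := f_ts _ (valP (x : vertex t)).
apply: ge_ereal_inf; exists (tdist (f u) (h x))%:R%:E; last first.
  by rewrite lee_fin -[leRHS]/1%:R ler_nat.
by exists (f u) => //; exists (SeqSub us).
Qed.

(* [m] matches the children of [s] with those of [t]; a value [m i >= size t]
   leaves the child [i] unmatched. *)
Lemma embeds_node A B (a : A) (b : B) (s : seq (rtree A)) (t : seq (rtree B))
    (leafA : rtree A) (leafB : rtree B) (m : nat -> nat) :
  {in gtn (size s) &, injective m} ->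
  (forall i, (i < size s)%N -> (m i < size t)%N ->
     embeds (nth leafA s i) (nth leafB t (m i))) ->
  (forall i, (i < size s)%N -> (size t <= m i)%N -> vertices (nth leafA s i) = [:: [::]]) ->
  (forall j, (j < size t)%N -> (exists2 i, (i < size s)%N & m i = j) \/
     vertices (nth leafB t j) = [:: [::]]) ->
  embeds (RNode a s) (RNode b t).
Proof.
move=> m_inj m_emb s_leaf t_leaf.
(* One map per child; for an unmatched child, a single vertex, the identity serves. *)
have /choice[f fP] i : exists f : addr -> addr, forall (si : (i < size s)%N),
  if (m i < size t)%N then
    [/\ f [::] = [::],
        {in vertices (nth leafA s i) &, forall u v, tdist (f u) (f v) = tdist u v},
        {in vertices (nth leafA s i), forall u, exists2 v,
          v \in vertices (nth leafB t (m i)) & (tdist (f u) v <= 1)%N} &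
        {in vertices (nth leafB t (m i)), forall v, exists2 u,
          u \in vertices (nth leafA s i) & (tdist (f u) v <= 1)%N}]
  else vertices (nth leafA s i) = [:: [::]] /\ f = id.
  have [si|] := ltnP i (size s); last by exists id.
  have [mt|mt] := ltnP (m i) (size t); last first.
    by exists id => _; rewrite s_leaf.
  by have [g gP] := m_emb i si mt; exists g.
have f0 i : (i < size s)%N -> f i [::] = [::].
  by move=> /(fP i); case: ifP => _ [] // _ ->.
have nthA i : (i < size s)%N -> nth (RNode a [::]) s i = nth leafA s i.
  by move=> si; apply: set_nth_default.
have nthB j : (j < size t)%N -> nth (RNode b [::]) t j = nth leafB t j.
  by move=> si; apply: set_nth_default.
have f_isom i : (i < size s)%N ->
    {in vertices (nth leafA s i) &, forall u v, tdist (f i u) (f i v) = tdist u v}.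
  by move=> /(fP i); case: ifP => _ [] // _ ->.
have f_size i u : (i < size s)%N -> u \in vertices (nth leafA s i) ->
    size (f i u) = size u.
  move=> si ui; rewrite -[LHS]tdist0r -(f0 i si) f_isom ?tdist0r //.
  exact: root_in_vertices.
(* An unmatched child is sent to the word [[:: m i]], outside [t] but adjacent to the root. *)
exists (fun u => if u is i :: v then m i :: f i v else [::]); split=> //.
- move=> [|i u] [|j v]; rewrite ?mem_vertices_cons //=.
  + by move=> _ /andP[sj vj]; rewrite f_size // -nthA.
  + by move=> /andP[si ui] _; rewrite !addn0 f_size // -nthA.
  + move=> /andP[si ui] /andP[sj vj].
    rewrite (inj_in_eq m_inj) //; have [ij|_] := eqVneq i j.
      by move: ui vj; rewrite -ij !nthA //; exact: f_isom.
    by rewrite !f_size // -nthA.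
- move=> [_|i u]; first by exists [::]; rewrite ?root_in_vertices.
  rewrite mem_vertices_cons => /andP[si]; rewrite nthA // => ui.
  have := fP i si; case: ifP => [mt [_ _ /(_ u ui)[v vt uv] _]|_].
    by exists (m i :: v); [rewrite mem_vertices_cons mt nthB|rewrite /= eqxx].
  case=> si1 ->; exists [::]; first exact: root_in_vertices.
  by move: ui; rewrite si1 inE => /eqP ->.
- move=> [_|j v]; first by exists [::]; rewrite ?root_in_vertices.
  rewrite mem_vertices_cons => /andP[tj]; rewrite nthB // => vj.
  case: (t_leaf j tj) => [[i si mi]|tj1]; last first.
    exists [::]; first exact: root_in_vertices.
    by move: vj; rewrite tj1 inE => /eqP ->.
  have := fP i si; rewrite mi tj => -[_ _ _ /(_ v vj)[u ui uv]].
  by exists (i :: u); [rewrite mem_vertices_cons si nthA|rewrite /= mi eqxx].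
Qed.

(** * Sums over trees and laws of fragmentations *)

Lemma rtree_ind_mem (A : choiceType) (P : rtree A -> Prop) :
  (forall a s, (forall t, t \in s -> P t) -> P (RNode a s)) -> forall t, P t.
Proof.
move=> PN; apply: rtree_ind_forall => a s IH; apply: PN.
elim: s IH => // t s IHs /= [Pt /IHs Ps] u.
by rewrite inE => /predU1P[->|/Ps].
Qed.

Section Sums.
Context {R : realType}.
Local Open Scope ereal_scope.

Lemma esum_ge_term (T : choiceType) (S : set T) (a : T -> \bar R) x :
  (forall y, 0 <= a y) -> S x -> a x <= \esum_(y in S) a y.
Proof.
by move=> a0 Sx; apply: esum_ge; exists [set x]; [split=> // y ->|rewrite fsbig_set1].
Qed.

(** The factor may be [+oo], because in [esum_prod_seq] it is itself a sum not known to be finite;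
    then either all terms vanish or both sides are [+oo]. *)
Lemma ge0_esumZl (T : choiceType) (S : set T) (a : T -> \bar R) (c : \bar R) :
  0 <= c -> (forall x, 0 <= a x) ->
  \esum_(x in S) (c * a x) = c * \esum_(x in S) a x.
Proof.
move=> c0 a0; case: c c0 => [r r0|_|//].
  rewrite /esum -ereal_supZl //; last first.
    by apply/set0P; exists (\sum_(x \in set0) a x), set0 => //; exact: fsets_set0.
  congr ereal_sup; apply/seteqP; split=> _ [X XS <-].
    by exists (\sum_(x \in X) a x); [exists X|rewrite ge0_mule_fsumr].
  by case: XS => Y YS <-; exists Y => //; rewrite ge0_mule_fsumr.
have [aS0|/existsNP[x /not_implyP[Sx /eqP ax0]]] := pselect (forall x, S x -> a x = 0).
  by rewrite !esum1 ?mule0 // => x /aS0 ->; rewrite mule0.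
have ax_gt0 : 0 < a x by rewrite lt_neqAle eq_sym ax0 a0.
rewrite gt0_mulye ?(lt_le_trans ax_gt0) ?esum_ge_term //.
apply/eqP; rewrite -leye_eq -{1}(gt0_mulye ax_gt0).
by apply: (@esum_ge_term _ _ (fun x => +oo * a x)) => // y; rewrite mule_ge0.
Qed.

Lemma esum_exchange (T1 T2 : choiceType) (I : set T1) (J : set T2)
    (a : T1 -> T2 -> \bar R) :
  (forall i j, I i -> J j -> 0 <= a i j) ->
  \esum_(i in I) \esum_(j in J) a i j = \esum_(j in J) \esum_(i in I) a i j.
Proof.
move=> a0; rewrite !esum_esum //; last by move=> i j Ji Ij; exact: a0.
rewrite (reindex_esum (J `*` I) _ (fun x => (x.2, x.1)))//; split=> //=.
- by move=> [i j] [/=].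
- by move=> [i1 i2] [j1 j2] /= _ _ [] -> ->.
- by move=> [i1 i2] [Pi1 Qi2] /=; exists (i2, i1).
Qed.

(** Distributivity, in the form that expresses independence of subtrees. With [g] the root label it
    handles the fragments of a split; with [g] constant it prescribes only the number of
    children. *)
Lemma esum_prod_seq (T K : choiceType) (g : T -> K) (f : T -> R) (ks : seq K) :
  (forall x, (0 <= f x)%R) ->
  \esum_(l in [set l | map g l = ks]) (\prod_(x <- l) f x)%:E =
  \prod_(k <- ks) \esum_(x in [set x | g x = k]) (f x)%:E.
Proof.
move=> f0; elim: ks => [|k ks IH].
  rewrite big_nil (_ : [set l | _] = [set [::]]) ?esum_set1 ?big_nil ?lee01 //.
  by apply/seteqP; split=> [[]|_ ->].
have pr0 (l : seq T) : (0 <= \prod_(x <- l) f x)%R by apply: prodr_ge0.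
rewrite big_cons -IH muleC -ge0_esumZl; last 2 first.
- by apply: esum_ge0 => l _; rewrite lee_fin.
- by move=> x; rewrite lee_fin.
rewrite (eq_esum (b := fun x => \esum_(l in [set l | map g l = ks])
    ((f x)%:E * (\prod_(y <- l) f y)%:E))); last first.
  by move=> x _; rewrite muleC ge0_esumZl ?lee_fin // => l; rewrite lee_fin.
rewrite esum_esum; last by move=> x l _ _; rewrite mule_ge0 ?lee_fin.
rewrite (reindex_esum ([set x | g x = k] `*`` (fun=> [set l | map g l = ks])) _
   (fun xl => xl.1 :: xl.2)).
  by apply: eq_esum => -[x l] _ /=; rewrite big_cons EFinM.
split.
- by move=> [x l] [/= <- <-].
- by move=> [x l] [y l'] _ _ [-> ->].
- by move=> [//|x l] [xk lks]; exists (x, l).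
Qed.

End Sums.

(** * The total mass of finite Galton-Watson trees *)

Section GaltonWatsonMass.
Context {R : realType} (nu : probability nat R).

(* [gw_prob] cut off at height [h]: makes the total mass bound an induction on [h]. *)
Fixpoint gw_prob_lt (h : nat) (t : tree) : R :=
  if h is h'.+1 then
    let: RNode _ s := t in
    fine (nu [set size s]) * \prod_(p <- map (gw_prob_lt h') s) p
  else 0.

Fixpoint height (t : tree) : nat :=
  let: RNode _ s := t in (foldr maxn 0%N (map height s)).+1.

Lemma gw_prob_ltE h t : (height t <= h)%N -> gw_prob_lt h t = gw_prob nu t.
Proof.
elim: h t => [|h IH] [a s] //=; rewrite ltnS => sh; congr (_ * _).
rewrite !big_map [LHS]big_seq [RHS]big_seq; apply: eq_bigr => t ts; apply: IH.
apply: leq_trans sh; elim: s ts => //= u s IHs; rewrite inE leq_max.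
by case/predU1P => [->|/IHs ->]; rewrite ?leqnn ?orbT.
Qed.

Lemma gw_prob_lt_ge0 h t : 0 <= gw_prob_lt h t.
Proof.
elim: h t => [|h IH] [a s] //=; rewrite mulr_ge0 ?fine_ge0 //.
by rewrite big_map prodr_ge0.
Qed.

Lemma gw_prob_ge0 t : 0 <= gw_prob nu t.
Proof. by rewrite -(@gw_prob_ltE (height t)) // gw_prob_lt_ge0. Qed.

Lemma esum_offspring : (\esum_(k in [set: nat]) nu [set k] = 1)%E.
Proof.
rewrite -nneseries_esumT; last by move=> k; exact: measure_ge0.
rewrite -(probability_setT nu) (_ : setT = \bigcup_k [set k]); last first.
  by apply/seteqP; split=> // k _; exists k.
rewrite measure_bigcup //; last by move=> i j _ _ [k [-> ->]].
by apply: eq_eseriesl => k; rewrite in_setT.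
Qed.

(** Trees whose root has k children contribute [nu [set k]] times the k-th power of the sum for the
    smaller height, which is at most 1 by induction. *)
Lemma esum_gw_prob_lt h : (\esum_(t in [set: tree]) (gw_prob_lt h t)%:E <= 1)%E.
Proof.
elim: h => [|h IH]; first by rewrite esum1.
rewrite (reindex_esum [set: seq tree] _ tnode); last first.
  by split=> // [s1 s2 _ _ []|[[] s]] // _; exists s.
rewrite -esum_offspring.
rewrite (_ : [set: seq tree] = \bigcup_(k in [set: nat]) [set s | size s = k]); last first.
  by apply/seteqP; split=> // s _; exists (size s).
rewrite esum_bigcupT; last 2 first.
- by move=> i j _ _ [s [<- <-]].
- by move=> s; rewrite lee_fin gw_prob_lt_ge0.
apply: le_esum => k _.
rewrite (eq_esum (b := fun s =>
    (nu [set k] * (\prod_(t <- s) gw_prob_lt h t)%:E)%E)); last first.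
  by move=> s /= <-; rewrite EFinM fineK ?big_map // fin_num_measure.
rewrite ge0_esumZl //; last first.
  by move=> s; rewrite lee_fin prodr_ge0 // => *; exact: gw_prob_lt_ge0.
rewrite -[leRHS]mule1 lee_wpmul2l //.
rewrite (_ : [set s | size s = k] = [set s | map (fun=> tt) s = nseq k tt]); last first.
  apply/seteqP; split=> s /= => [<-|]; last by move/(congr1 size); rewrite size_map size_nseq.
  by elim: s => //= _ s ->.
rewrite esum_prod_seq; last exact: gw_prob_lt_ge0.
rewrite big_seq.
suff /andP[_ //] : (0 <= (\prod_(i <- nseq k tt | i \in nseq k tt)
   \esum_(x in [set x | (fun=> tt) x = i]) (gw_prob_lt h x)%:E) <= 1)%E.
apply: (big_rec (fun x : \bar R => 0 <= x <= 1)%E) => [|i x _ /andP[x0 x1]].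
  by rewrite lee01 lexx.
rewrite (_ : [set _ | _] = setT); last by apply/seteqP; split=> y _ //=; case: i.
have S0 : (0 <= \esum_(x in [set: tree]) (gw_prob_lt h x)%:E)%E.
  by apply: esum_ge0 => x' _; rewrite lee_fin gw_prob_lt_ge0.
by rewrite mule_ge0 //= -[leRHS]mule1 lee_pmul.
Qed.

(** Finitely many trees have bounded height, so each finite partial sum is one of [gw_prob_lt]. Only
    an inequality can hold: a supercritical tree is infinite with positive probability. *)
Lemma esum_gw_prob : (\esum_(t in [set: tree]) (gw_prob nu t)%:E <= 1)%E.
Proof.
apply: ge_ereal_sup => _ [X [finX _] <-].
pose h := \max_(t <- fset_set X) height t.
apply: le_trans (esum_gw_prob_lt h).
apply: ereal_sup_ubound; exists X => //.
apply: eq_fsbigr => t; rewrite inE => Xt; rewrite gw_prob_ltE //.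
by apply: (@leq_bigmax_seq _ _ xpredT) => //; rewrite in_fset_set // inE.
Qed.

End GaltonWatsonMass.

(** * Total mass of a general fragmentation *)

Section Fragmentation.
Context {R : realType} {S V : choiceType}.
Variables (terminal : pred S) (choices : S -> seq V) (weight : S -> V -> R)
  (fragments : S -> V -> seq S).

(** The common form of [HW_split_prob] and [D_split_prob], which are instances of it by
    conversion. *)
Fixpoint split_prob (c : rtree S) : R :=
  let: RNode C s := c in
  if terminal C then (s == [::])%:R
  else (\sum_(v <- choices C | map (@label _) s == fragments C v) weight C v)
       * \prod_(p <- map split_prob s) p.

Hypothesis weight_ge0 : forall C v, ~~ terminal C -> v \in choices C ->
  0 <= weight C v.

Lemma split_prob_ge0 c : 0 <= split_prob c.
Proof.
elim/rtree_ind_mem : c => C s IH /=; case: ifPn => [_|tC]; first by rewrite ler0n.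
rewrite mulr_ge0 //.
  by rewrite big_seq_cond sumr_ge0 // => v /andP[vC _]; exact: weight_ge0.
by rewrite big_map big_seq prodr_ge0.
Qed.

Variables (inv : S -> Prop) (mass : S -> nat).

Hypothesis sum_weight : forall C, inv C -> ~~ terminal C ->
  \sum_(v <- choices C) weight C v = 1.
Hypothesis inv_fragments : forall C v D, inv C -> ~~ terminal C ->
  v \in choices C -> D \in fragments C v -> inv D.
Hypothesis mass_fragments : forall C v D, inv C -> ~~ terminal C ->
  v \in choices C -> D \in fragments C v -> (mass D < mass C)%N.

(** Induction on [mass], which drops at every split. For a fixed split vertex the sum over the
    children factorizes into total masses of the fragments, all 1; the weights then sum to 1. *)
Lemma esum_split_prob C : inv C ->
  (\esum_(c in [set c | label c = C]) (split_prob c)%:E = 1)%E.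
Proof.
have [k] := ubnP (mass C); elim: k C => // k IH C; rewrite ltnS => Ck iC.
rewrite (reindex_esum [set: seq (rtree S)] _ (RNode C)); last first.
  by split=> // [s1 s2 _ _ []|[D s] /= <-] //; exists s.
have [tC|tC] := boolP (terminal C).
  rewrite (esumID [set [::]]) ?setTI; last by move=> s _; rewrite lee_fin split_prob_ge0.
  rewrite esum_set1 /= tC ?eqxx ?lee_fin ?ler01 // esum1 ?adde0 // => s /eqP sN.
  by rewrite (negbTE sN).
pose Z s := \prod_(x <- s) split_prob x.
have Z0 s : 0 <= Z s by apply: prodr_ge0 => x _; exact: split_prob_ge0.
(* The redundant condition [v \in choices C] is kept because the weights are known to be
   non-negative only there. *)
transitivity (\esum_(s in [set: seq (rtree S)])
    \sum_(v <- choices C | v \in choices C) (if map (@label _) s == fragments C v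
       then (weight C v)%:E * (Z s)%:E else 0))%E.
  apply: eq_esum => s _ /=; rewrite (negbTE tC) big_map big_mkcond mulr_suml.
  rewrite -sumEFin big_seq; apply: eq_bigr => v _; case: ifP => _; first by rewrite EFinM.
  by rewrite mul0r.
rewrite esum_sum; last first.
  by move=> s v _ vC; case: ifP => // _; rewrite mule_ge0 ?lee_fin ?weight_ge0.
transitivity (\sum_(v <- choices C | v \in choices C) (weight C v)%:E)%E; last first.
  by rewrite -big_seq sumEFin sum_weight.
apply: eq_bigr => v vC.
transitivity (\esum_(s in [set s | map (@label _) s = fragments C v])
   ((weight C v)%:E * (Z s)%:E))%E.
  rewrite [RHS]esum_mkcond; apply: eq_esum => s _.
  by congr (if _ then _ else _); apply/eqP/idP; rewrite inE.
rewrite ge0_esumZl ?lee_fin ?weight_ge0 //.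
rewrite esum_prod_seq ?big_seq; last exact: split_prob_ge0.
rewrite big1 ?mule1 // => D DC; apply: IH; last exact: inv_fragments DC.
exact: leq_trans (mass_fragments iC tC vC DC) Ck.
Qed.

End Fragmentation.

(** * The probability measure with given point masses *)

Section DiscreteLaw.
Context {R : realType} {d : measure_display} {T : measurableType d}.
Local Open Scope ereal_scope.
Variable p : T -> \bar R.
Hypothesis p0 : forall x, 0 <= p x.
Hypothesis p1 : \esum_(x in [set: T]) p x = 1.

Let law (A : set T) : \bar R := \esum_(x in A) p x.

Let law0 : law set0 = 0.
Proof. exact: esum_set0. Qed.

Let law_ge0 A : 0 <= law A.
Proof. by apply: esum_ge0 => x _. Qed.

Let law_sigma_additive : semi_sigma_additive law.
Proof.
move=> F mF tF mUF; rewrite /law esum_bigcupT // -nneseries_esumT; last first.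
  by move=> n; exact: law_ge0.
by apply: is_cvg_nneseries => n _ _; exact: law_ge0.
Qed.

HB.instance Definition _ :=
  isMeasure.Build d T R law law0 law_ge0 law_sigma_additive.

HB.instance Definition _ := Measure_isProbability.Build d T R law p1.

Definition discrete_law : probability T R := law.

Lemma discrete_lawE A : discrete_law A = \esum_(x in A) p x.
Proof. by []. Qed.

End DiscreteLaw.

(** * Components of planar trees *)

Section Prefixes.
Implicit Types u v w : addr.

Lemma prefix_rconsE v u i : prefix v (rcons u i) = (v == rcons u i) || prefix v u.
Proof.
apply/idP/orP => [/prefixP[x]|[/eqP ->|/prefixP[x ->]]]; last 2 first.
- exact: prefix_refl.
- by rewrite rcons_cat prefix_prefix.
case/lastP: x => [|x j]; first by rewrite cats0 => <-; left.
by rewrite -rcons_cat => /rcons_inj[-> _]; right; exact: prefix_prefix.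
Qed.

Lemma prefix_rconsN u i : prefix (rcons u i) u = false.
Proof. by apply/negP => /size_prefix; rewrite size_rcons ltnn. Qed.

Lemma strict_prefix_rcons v u i :
  (rcons u i != v) && prefix v (rcons u i) = prefix v u.
Proof.
rewrite prefix_rconsE eq_sym; case: eqP => [->|_] //=.
by rewrite prefix_rconsN.
Qed.

Lemma prefix_same_size v w u :
  prefix v u -> prefix w u -> size v = size w -> v = w.
Proof. by rewrite !prefixE => /eqP vu /eqP wu vw; rewrite -vu -wu vw. Qed.

Lemma prefix_anti u v : prefix u v -> prefix v u -> u = v.
Proof.
move=> uv vu; move: (uv); rewrite prefixE take_oversize ?size_prefix // => /eqP ->.
by [].
Qed.

Lemma child_ofP v w : reflect (exists i, w = rcons v i) (child_of v w).
Proof.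
by apply: (iffP eqP) => [->|[i ->]]; [exists (last 0 w)%N|rewrite last_rcons].
Qed.

Lemma child_of_rcons u v i : child_of v (rcons u i) = (u == v).
Proof. by rewrite /child_of last_rcons eqseq_rcons eqxx andbT. Qed.

Lemma parent_rcons v i : take (size (rcons v i)).-1 (rcons v i) = v.
Proof. by rewrite size_rcons -cats1 take_size_cat. Qed.

End Prefixes.

Section Components.
Local Open Scope fset_scope.
Local Open Scope nat_scope.
Implicit Types (C E : component) (u v w : addr).

Definition degree C v : nat := #|` children C v|.

Lemma in_children E v w : (w \in children E v) = (w \in E) && child_of v w.
Proof. by rewrite !inE. Qed.

Lemma in_above E v u : (u \in above v E) = (u \in E) && prefix v u.
Proof. by rewrite !inE. Qed.

Lemma in_strictly_above E v u :
  (u \in strictly_above v E) = [&& u != v, u \in E & prefix v u].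
Proof. by rewrite !inE. Qed.

Lemma rcons_strictly_above E v u i :
  (rcons u i \in strictly_above v E) = (rcons u i \in E) && prefix v u.
Proof. by rewrite in_strictly_above andbCA strict_prefix_rcons. Qed.

Lemma rcons_prune E v u i : (rcons u i \in E `\` strictly_above v E) =
  (rcons u i \in E) && ~~ prefix v u.
Proof. by rewrite in_fsetD rcons_strictly_above; case: (_ \in E); rewrite ?andbT. Qed.

Lemma degreeE E v d : (forall i, (rcons v i \in E) = (i < d)) -> degree E v = d.
Proof.
move=> Ed; rewrite /degree -[RHS](size_iota 0) -(size_map (rcons v)).
apply/perm_size/uniq_perm => [||w]; first exact: fset_uniq.
  by rewrite map_inj_uniq ?iota_uniq // => i j /rcons_inj[].
rewrite in_children; apply/andP/mapP => [[wE /child_ofP[i wi]]|[i + ->]].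
  by exists i; rewrite // mem_iota add0n -Ed -wi.
by rewrite mem_iota add0n -Ed child_of_rcons eqxx.
Qed.

Lemma eq_degree C E v :
  (forall i, (rcons v i \in C) = (rcons v i \in E)) -> degree C v = degree E v.
Proof.
move=> CE; congr #|` _|; apply/fsetP => w; rewrite !in_children.
by apply/andP/andP => -[+ /child_ofP[i wi]]; rewrite wi CE child_of_rcons eqxx.
Qed.

Lemma degree0 E v : (forall i, rcons v i \notin E) -> degree E v = 0.
Proof. by move=> Ev; apply: degreeE => i; rewrite (negbTE (Ev i)). Qed.

Lemma degree_above C w u : prefix w u -> degree (above w C) u = degree C u.
Proof.
by move=> wu; apply: eq_degree => i; rewrite in_above prefix_rconsE wu orbT andbT.
Qed.

Lemma degree_prune C v u : degree (C `\` strictly_above v C) u =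
  if prefix v u then 0 else degree C u.
Proof.
case: ifPn => vu.
  by apply: degree0 => i; rewrite inE rcons_strictly_above vu andbT andNb.
by apply: eq_degree => i; rewrite inE rcons_strictly_above (negbTE vu) andbF.
Qed.

Lemma sum_pred_count (T : Type) (P : pred T) (s : seq T) :
  \sum_(x <- s) (P x : nat) = count P s.
Proof. by elim: s => [|x s IH]; rewrite ?big_nil // big_cons IH. Qed.

(** Double counting: each address in [E] has exactly one parent, listed once in [vs]. *)
Lemma sum_degree E (vs : seq addr) : uniq vs ->
  (forall w, w \in E -> exists2 v, v \in vs & child_of v w) ->
  \sum_(v <- vs) degree E v = #|` E|.
Proof.
move=> vs_uniq Evs.
have degE v : degree E v = \sum_(w <- E) child_of v w.
  rewrite sum_pred_count -size_filter; apply/perm_size/uniq_perm => [||w].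
  - exact: fset_uniq.
  - by rewrite filter_uniq ?fset_uniq.
  - by rewrite in_children mem_filter andbC.
under eq_bigr do rewrite degE; rewrite exchange_big /= card_fset_sum1.
rewrite [RHS]big_seq [LHS]big_seq; apply: eq_bigr => w /Evs [v vvs /child_ofP[i wi]].
rewrite sum_pred_count -(_ : count_mem v vs = 1); last by rewrite count_uniq_mem ?vvs.
by apply: eq_count => u /=; rewrite wi child_of_rcons eq_sym.
Qed.

(* [C] is the vertex set of a subtree rooted at [r], in which a vertex keeps
   either all its children or none, and no vertex has exactly one child. *)
Definition tree_like C : Prop :=
  exists2 r, r \in C & forall v, v \in C ->
    [/\ prefix r v, v != r -> exists2 u, u \in C & child_of u v,
        degree C v != 1 & forall i, (rcons v i \in C) = (i < degree C v)].

Lemma mem_comp_leaves C v : (v \in comp_leaves C) = (v \in C) && (degree C v == 0).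
Proof. by rewrite !inE /degree cardfs_eq0. Qed.

Lemma mem_branch C v : (v \in comp_branch_points C) = (v \in C) && (degree C v != 0).
Proof.
by rewrite in_fsetD mem_comp_leaves; case: (v \in C); rewrite ?andbF ?andbT.
Qed.

Lemma card_comp_leaves C : tree_like C ->
  #|` comp_leaves C| = (\sum_(v <- C) (degree C v).-1).+1.
Proof.
move=> [r rC Cr].
have S1 : \sum_(v <- C) degree C v = #|` C `\ r|.
  rewrite -(@sum_degree _ C) ?fset_uniq //; last first.
    by move=> w; rewrite !inE => /andP[wr /Cr[_ /(_ wr)]].
  rewrite [LHS]big_seq [RHS]big_seq; apply: eq_bigr => v /Cr[rv _ _ _].
  apply: eq_degree => i; rewrite !inE; case: eqP => // E.
  by move: rv; rewrite -E prefix_rconsN.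
have S2 : #|` comp_leaves C| = \sum_(v <- C) (degree C v == 0).
  rewrite sum_pred_count -size_filter; apply/perm_size/uniq_perm => [||w].
  - exact: fset_uniq.
  - by rewrite filter_uniq ?fset_uniq.
  - by rewrite mem_comp_leaves mem_filter andbC.
have S3 : \sum_(v <- C) degree C v + \sum_(v <- C) (degree C v == 0) =
    \sum_(v <- C) (degree C v).-1 + #|` C|.
  rewrite card_fset_sum1 -!big_split /=; apply: eq_bigr => v _.
  by case: (degree C v) => //= n; rewrite addn0 addn1.
move: S3; rewrite S1 -S2 [#|` C|](cardfsD1 r) rC; lia.
Qed.

(* [add_leaves] turns k >= 2 children into 2k - 2; the truncated subtraction makes
   a leaf contribute nothing. *)
Definition doubled C : component :=
  [fset w in flatten [seq [seq rcons v i | i <- iota 0 ((degree C v).*2 - 2)]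
                     | v <- C]].

Lemma rcons_doubled C v i :
  (rcons v i \in doubled C) = (v \in C) && (i < (degree C v).*2 - 2).
Proof.
rewrite !inE; apply/flatten_mapP/andP => [[u uC /mapP[j + /rcons_inj[-> ->]]]|[vC id]].
  by rewrite mem_iota add0n.
by exists v => //; apply/mapP; exists i => //; rewrite mem_iota add0n.
Qed.

Lemma nil_doubled C : [::] \notin doubled C.
Proof.
rewrite !inE; apply/negP => /flatten_mapP[u uC /mapP[j _ /(congr1 size)]].
by rewrite size_rcons.
Qed.

Lemma doubledP C E : [::] \notin E ->
  (forall v i, (rcons v i \in E) = (v \in C) && (i < (degree C v).*2 - 2)) ->
  E = doubled C.
Proof.
move=> nE EC; apply/fsetP; case/lastP => [|v i].
  by rewrite (negbTE nE) (negbTE (nil_doubled C)).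
by rewrite rcons_doubled EC.
Qed.

Lemma degree_doubled C v : v \in C -> degree (doubled C) v = (degree C v).*2 - 2.
Proof. by move=> vC; apply: degreeE => i; rewrite rcons_doubled vC. Qed.

Lemma card_doubled C : tree_like C -> #|` doubled C| = (#|` comp_leaves C|.-1).*2.
Proof.
move=> Ct; rewrite card_comp_leaves //= -(@sum_degree _ C) ?fset_uniq //; last first.
  case/lastP => [|v i]; first by rewrite (negbTE (nil_doubled C)).
  by rewrite rcons_doubled => /andP[vC _]; exists v => //; rewrite child_of_rcons.
rewrite -muln2 big_distrl /= [LHS]big_seq [RHS]big_seq; apply: eq_bigr => v vC.
by rewrite degree_doubled //; lia.
Qed.

(** Vertices above [w] keep their degrees, and an edge lies strictly above [w] when its lower
    endpoint lies above [w]. *)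
Lemma doubled_above C w : doubled (above w C) = strictly_above w (doubled C).
Proof.
apply/esym/doubledP => [|u i].
  by rewrite in_strictly_above (negbTE (nil_doubled C)) andbF.
rewrite rcons_strictly_above rcons_doubled in_above; case: (boolP (prefix w u)) => wu.
  by rewrite degree_above // !andbT.
by rewrite !andbF.
Qed.

(** The split vertex stays in the lower part as a leaf, and there [0.*2 - 2] is 0, in agreement with
    the removal of all its edges. *)
Lemma doubled_prune C v :
  doubled (C `\` strictly_above v C) = doubled C `\` strictly_above v (doubled C).
Proof.
apply/esym/doubledP => [|u i]; first by rewrite inE (negbTE (nil_doubled C)) andbF.
rewrite in_fsetD rcons_strictly_above rcons_doubled in_fsetD in_strictly_above degree_prune.
case: (boolP (prefix v u)) => vu; first by rewrite ltn0 !andbF andbT andNb.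
by rewrite !andbF.
Qed.

Lemma tree_like_above C w : tree_like C -> w \in C -> tree_like (above w C).
Proof.
move=> [r rC Cr] wC; exists w; first by rewrite in_above wC prefix_refl.
move=> v; rewrite in_above => /andP[vC wv]; have [rv vP v1 vi] := Cr v vC.
rewrite degree_above //; split=> // [vw|i]; last first.
  by rewrite in_above prefix_rconsE wv orbT andbT.
have [u uC uv] : exists2 u, u \in C & child_of u v.
  apply: vP; apply: contraNneq vw => vr; have [rw _ _ _] := Cr w wC.
  by rewrite vr; apply/eqP/prefix_anti => //; rewrite -vr.
exists u => //; rewrite in_above uC /=; case/child_ofP: uv => i vi'.
by move: wv; rewrite vi' prefix_rconsE -vi' eq_sym (negbTE vw).
Qed.

Lemma tree_like_prune C v : tree_like C -> v \in C ->
  tree_like (C `\` strictly_above v C).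
Proof.
move=> [r rC Cr] vC; exists r.
  rewrite in_fsetD in_strictly_above rC andbT /= negb_and negbK orbC -implybE.
  apply/implyP => vr; have [rv _ _ _] := Cr v vC.
  by apply/eqP/prefix_anti.
move=> u; rewrite in_fsetD => /andP[uNv uC]; have [ru uP u1 ui] := Cr u uC.
rewrite degree_prune; split=> //; [move=> /uP[w wC wu]|by case: ifP|move=> i].
  exists w => //; rewrite in_fsetD wC andbT in_strictly_above wC /=.
  case/child_ofP: wu => i wi; move: uNv; rewrite wi rcons_strictly_above -wi uC /=.
  by move/negbTE ->; rewrite andbF.
rewrite in_fsetD rcons_strictly_above ui.
by case: (prefix v u); rewrite ?andbT ?andbF ?andNb ?ltn0.
Qed.

Lemma tree_like_HW_fragments C v D : tree_like C -> v \in C ->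
  D \in HW_fragments C v -> tree_like D.
Proof.
move=> Ct vC; rewrite inE => /predU1P[->|/mapP[w + ->]]; first exact: tree_like_prune.
by rewrite in_children => /andP[wC _]; exact: tree_like_above.
Qed.

(** Going from [u] to parents never leaves [C] before [r] is reached, and [w] is met on the way. *)
Lemma mem_between C r u w : r \in C ->
  (forall v, v \in C -> v != r -> exists2 u, u \in C & child_of u v) ->
  u \in C -> prefix w u -> prefix r w -> w \in C.
Proof.
move=> rC Cr; elim/last_ind: u => [|u i IH] uC.
  by rewrite prefixs0 => /eqP ->.
rewrite prefix_rconsE => /predU1P[->//|wu rw].
have [ui|/(Cr _ uC)] := eqVneq (rcons u i) r.
  have := prefix_trans rw wu; by rewrite -ui prefix_rconsN.
by case=> u' u'C; rewrite child_of_rcons => /eqP uu'; apply: IH => //; rewrite uu'.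
Qed.

(** The first fragment suffices: it misses every child of [v], so these lie strictly above [w] and
    [w] is a prefix of [v]; then by symmetry. Hence each sum in [HW_split_prob] has at most one
    term. *)
Lemma HW_fragments_inj C : {in comp_branch_points C &, injective (HW_fragments C)}.
Proof.
have pre v w : v \in comp_branch_points C -> HW_fragments C v = HW_fragments C w ->
    prefix w v.
  rewrite mem_branch => /andP[vC]; rewrite /degree cardfs_eq0 => /fset0Pn[x].
  rewrite in_children => /andP[xC /child_ofP[i xi]] [/fsetP/(_ x) + _].
  by rewrite xi !rcons_prune -xi xC prefix_refl /= => /esym/negbFE.
move=> v w vC wC vw; apply: prefix_anti; first exact: pre wC (esym vw).
exact: pre vC vw.
Qed.

Lemma mem_lower_endpoints E v : [::] \notin E ->
  (v \in lower_endpoints E) = (degree E v != 0).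
Proof.
move=> nE; rewrite /degree cardfs_eq0; apply/imfsetP/fset0Pn => [[w /= wE ->]|[w]].
  exists w; rewrite in_children wE /=; case/lastP: w wE => [|w i] wE.
    by rewrite (negbTE nE) in wE.
  by rewrite parent_rcons child_of_rcons.
rewrite in_children => /andP[wE /child_ofP[i wi]]; exists w => //=.
by rewrite wi parent_rcons.
Qed.

(** The first fragment is a single edge just above the split vertex, which is its lower endpoint. *)
Lemma D_fragments_inj E : [::] \notin E ->
  {in lower_endpoints E &, injective (D_fragments E)}.
Proof.
move=> nE v w; rewrite !mem_lower_endpoints // /degree !cardfs_eq0 /D_fragments.
move=> /fset0Pn[x xv] /fset0Pn[y yw].
have allc u : all (child_of u) (children E u).
  by apply/allP => z; rewrite in_children => /andP[].
have := allc v; have := allc w; move: xv yw.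
rewrite -[x \in _]/(x \in enum_fset _) -[y \in _]/(y \in enum_fset _).
case: (enum_fset (children E v)) => // x' s _.
case: (enum_fset (children E w)) => // y' s' _ /= /andP[/child_ofP[j ->] _].
move=> /andP[/child_ofP[i ->] _] [/fset1_inj/rcons_inj[-> _]] _.
by [].
Qed.

(** The fragments are non-empty and pairwise disjoint. That none repeats is what allows a child to
    be found by its label. *)
Lemma D_fragments_uniq E v : uniq (D_fragments E v).
Proof.
have sizec w : w \in children E v -> prefix v w /\ size w = (size v).+1.
  rewrite in_children => /andP[_ /child_ofP[i ->]].
  by rewrite size_rcons -cats1 prefix_prefix.
have nsa w x : w \in children E v -> x \in strictly_above w E ->
    [/\ x \in strictly_above v E, prefix w x & x != w].
  move=> wv; rewrite in_strictly_above => /and3P[xw xE wx]; split=> //.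
  have [vw sw] := sizec w wv; rewrite in_strictly_above xE (prefix_trans vw wx) !andbT.
  by apply: contraTneq wx => ->; apply/negP => /size_prefix; rewrite sw ltnn.
have cE w : w \in children E v -> w \in strictly_above v E.
  rewrite in_children => /andP[wE /child_ofP[i wi]].
  by rewrite wi rcons_strictly_above -wi wE prefix_refl.
rewrite /D_fragments cat_uniq map_inj_uniq ?fset_uniq; last exact: fset1_inj.
rewrite andTb.
apply/andP; split.
  apply/hasPn => D; rewrite mem_filter => /andP[D0 DD].
  apply/mapP => -[w wv Dw]; move: DD; rewrite {D}Dw in D0 *.
  rewrite inE => /predU1P[/fsetP/(_ w)|/mapP[u uv /fsetP/(_ w)]].
    by rewrite in_fsetD cE // inE eqxx.
  rewrite inE eqxx => /esym wu; have [_ uw] := nsa u w uv wu.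
  have [vw sw] := sizec w wv; have [vu su] := sizec u uv.
  by rewrite (prefix_same_size uw (prefix_refl w)) ?su ?eqxx.
rewrite /=.
set L := [seq D <- [seq _ | _ <- _] | _].
have L_uniq : uniq L.
  rewrite /L filter_map map_inj_in_uniq ?filter_uniq ?fset_uniq // => u w.
  rewrite !mem_filter /= => /andP[/fset0Pn[x xu] uv] /andP[_ wv] uw.
  have [_ ux _] := nsa u x uv xu; rewrite uw in xu; have [_ wx _] := nsa w x wv xu.
  by apply: (prefix_same_size ux wx); rewrite (sizec u uv).2 (sizec w wv).2.
case: ifP => //= _; rewrite L_uniq andbT.
apply/negP; rewrite mem_filter => /andP[/fset0Pn[x + ] /mapP[u uv DE]].
move=> xD; have : x \in strictly_above u E by rewrite -DE.
by move=> /(nsa u x uv)[xv _ _]; move: xD; rewrite in_fsetD xv.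
Qed.

(** Nothing lies above the k - 2 edges that doubling adds at [v], so their parts are empty and
    filtered out; the other parts are the doubled fragments. *)
Lemma perm_D_fragments C v : tree_like C -> v \in comp_branch_points C ->
  perm_eq (D_fragments (doubled C) v)
    ([seq [fset w] | w <- children (doubled C) v] ++
     [seq D <- map doubled (HW_fragments C v) | D != fset0]).
Proof.
move=> Ct; rewrite mem_branch => /andP[vC v0]; rewrite /D_fragments perm_cat2l.
rewrite /= doubled_prune -map_comp.
have -> : [seq (doubled \o (above^~ C)) i | i <- children C v] =
    [seq strictly_above w (doubled C) | w <- children C v].
  by apply: eq_map => w /=; rewrite doubled_above.
suff P : perm_eq
    [seq D <- [seq strictly_above w (doubled C) | w <- children (doubled C) v] | D != fset0]
    [seq D <- [seq strictly_above w (doubled C) | w <- children C v] | D != fset0].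
  by case: ifP => // _; rewrite perm_cons.
rewrite !filter_map; apply/perm_map/uniq_perm; rewrite ?filter_uniq ?fset_uniq // => w.
rewrite !mem_filter /=; case: fset0Pn => //= -[x].
case/lastP: x => [|x j]; first by rewrite in_strictly_above (negbTE (nil_doubled C)) andbF.
rewrite rcons_strictly_above rcons_doubled => /andP[/andP[xC _] wx].
rewrite !in_children; case: (boolP (child_of v w)) => [/child_ofP[i wi]|]; last first.
  by rewrite !andbF.
rewrite !andbT {1}wi rcons_doubled vC /=; have [r rC Cr] := Ct.
have [rv vP v1 vi] := Cr v vC.
have wC : w \in C.
  apply: (@mem_between C r x w) => //; first by move=> u /Cr[].
  by rewrite wi prefix_rconsE rv orbT.
(* As the degree k is not 1, an index below k is also below 2k - 2. *)
by rewrite wC; move: wC; rewrite wi vi; lia.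
Qed.

End Components.

(** * The map between the cut-trees *)

Section Laws.
Context {R : realType}.
Local Open Scope fset_scope.

Definition HW_weight (C : component) (v : addr) : R :=
  (#|` children C v|%:R - 1) / (#|` comp_leaves C|%:R - 1).

Definition D_weight (E : component) (v : addr) : R :=
  #|` children E v|%:R / #|` E|%:R.

Lemma HW_split_probE : HW_split_prob = split_prob
  (fun C : component => (#|` comp_leaves C| < 2)%N)
  (fun C : component => comp_branch_points C : seq addr)
  HW_weight HW_fragments.
Proof. by []. Qed.

Lemma D_split_probE : D_split_prob = split_prob
  (fun E : component => (#|` E| < 2)%N) (fun E : component => lower_endpoints E : seq addr)
  D_weight D_fragments.
Proof. by []. Qed.

Lemma HW_weight_ge0 C v : ~~ (#|` comp_leaves C| < 2)%N ->
  v \in comp_branch_points C -> 0 <= HW_weight C v.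
Proof.
rewrite -leqNgt mem_branch => m2 /andP[_ k0]; rewrite /HW_weight.
by rewrite divr_ge0 // subr_ge0 ler1n; [rewrite lt0n|exact: leq_trans m2].
Qed.

Lemma D_weight_ge0 E v : 0 <= D_weight E v.
Proof. by rewrite divr_ge0. Qed.

Lemma HW_split_prob_ge0 c : 0 <= HW_split_prob c :> R.
Proof. by rewrite HW_split_probE split_prob_ge0 //; exact: HW_weight_ge0. Qed.

Lemma D_split_prob_ge0 c : 0 <= D_split_prob c :> R.
Proof. by rewrite D_split_probE split_prob_ge0 // => *; exact: D_weight_ge0. Qed.

Lemma sum_HW_weight C : tree_like C -> ~~ (#|` comp_leaves C| < 2)%N ->
  \sum_(v <- comp_branch_points C) HW_weight C v = 1.
Proof.
move=> Ct; rewrite -leqNgt => m2.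
have m1 : (#|` comp_leaves C|%:R - 1 : R) = (#|` comp_leaves C|.-1)%:R.
  by rewrite -subn1 natrB // (leq_trans _ m2).
rewrite -mulr_suml m1 (_ : \sum_(v <- _) _ = (#|` comp_leaves C|.-1)%:R).
  by rewrite divff // pnatr_eq0; lia.
rewrite card_comp_leaves //= natr_sum.
have P : perm_eq (comp_branch_points C) [seq v <- C | degree C v != 0%N].
  apply: uniq_perm; rewrite ?filter_uniq ?fset_uniq // => v.
  by rewrite mem_filter -[v \in enum_fset _]/(v \in comp_branch_points C) mem_branch andbC.
rewrite (perm_big _ P) big_filter big_mkcond; apply: eq_bigr => v _.
rewrite -[#|` children C v|]/(degree C v).
by case: (degree C v) => //= k; rewrite -addn1 natrD addrK.
Qed.

Lemma sum_D_weight E : [::] \notin E -> ~~ (#|` E| < 2)%N ->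
  \sum_(v <- lower_endpoints E) D_weight E v = 1.
Proof.
move=> nE; rewrite -leqNgt => m2; rewrite -mulr_suml -natr_sum.
rewrite (@sum_degree E) ?fset_uniq //.
  by rewrite divff // pnatr_eq0; lia.
move=> w wE; have [i wi] : exists i, w = rcons (take (size w).-1 w) i.
  case/lastP: w wE => [|w i] wE; first by rewrite (negbTE nE) in wE.
  by exists i; rewrite parent_rcons.
exists (take (size w).-1 w); last by apply/child_ofP; exists i.
by apply/imfsetP; exists w.
Qed.

Lemma card_HW_fragments C v F : tree_like C -> v \in comp_branch_points C ->
  F \in HW_fragments C v -> (#|` F| < #|` C|)%N.
Proof.
move=> Ct; rewrite mem_branch => /andP[vC v0].
rewrite inE => /predU1P[->|/mapP[w wv ->]]; apply: fproper_ltn_card; rewrite fproperE.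
  have [w] : exists w, w \in children C v by apply/fset0Pn; rewrite -cardfs_eq0.
  rewrite in_children => /andP[wC /child_ofP[i wi]].
  apply/andP; split; first by apply/fsubsetP => x; rewrite in_fsetD => /andP[].
  by apply/fsubsetPn; exists w => //; rewrite wi rcons_prune prefix_refl andbF.
apply/andP; split; first by apply/fsubsetP => x; rewrite in_above => /andP[].
apply/fsubsetPn; exists v => //; rewrite in_above vC /=.
move: wv; rewrite in_children => /andP[_ /child_ofP[i ->]].
by rewrite prefix_rconsN.
Qed.

Lemma card_D_fragments E v F : [::] \notin E -> ~~ (#|` E| < 2)%N ->
  v \in lower_endpoints E -> F \in D_fragments E v ->
  [::] \notin F /\ (#|` F| < #|` E|)%N.
Proof.
move=> nE; rewrite -leqNgt => m2; rewrite mem_lower_endpoints // /degree cardfs_eq0.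
move=> /fset0Pn[w]; rewrite in_children => /andP[wE /child_ofP[i wi]].
have sub (D : component) x : D `<=` E -> x \in E -> x \notin D ->
    [::] \notin D /\ (#|` D| < #|` E|)%N.
  move=> DE xE xD; split; first by apply: contra nE; exact: fsubsetP.
  by apply: fproper_ltn_card; rewrite fproperE DE; apply/fsubsetPn; exists x.
rewrite mem_cat => /orP[/mapP[u + ->]|].
  rewrite in_children => /andP[uE _]; split; last by rewrite cardfs1.
  by rewrite inE; apply: contraNneq nE => ->.
rewrite mem_filter inE => /andP[_ /predU1P[->|/mapP[u + ->]]].
  apply: (sub _ w) => //; first by apply/fsubsetP => x; rewrite in_fsetD => /andP[].
  by rewrite wi rcons_prune prefix_refl andbF.
rewrite in_children => /andP[uE _]; apply: (sub _ u) => //.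
  by apply/fsubsetP => x; rewrite in_strictly_above => /and3P[].
by rewrite in_strictly_above eqxx.
Qed.

Lemma esum_HW_split_prob (C : component) : tree_like C ->
  (\esum_(c in [set c | label c = C]) (HW_split_prob c : R)%:E = 1)%E.
Proof.
rewrite HW_split_probE.
apply: (@esum_split_prob _ _ _ _ _ _ _ _ tree_like
  (fun C : component => #|` C|)).
- exact: HW_weight_ge0.
- exact: sum_HW_weight.
- by move=> D v F Dt _; rewrite mem_branch => /andP[vD _]; exact: tree_like_HW_fragments.
- by move=> D v F Dt _; exact: card_HW_fragments.
Qed.

Lemma esum_D_split_prob (E : component) : [::] \notin E ->
  (\esum_(c in [set c | label c = E]) (D_split_prob c : R)%:E = 1)%E.
Proof.
rewrite D_split_probE.
apply: (@esum_split_prob _ _ _ _ _ _ _ _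
  (fun E : component => [::] \notin E)
  (fun E : component => #|` E|)).
- by move=> *; exact: D_weight_ge0.
- exact: sum_D_weight.
- by move=> D v F Dt m2 vD /(card_D_fragments Dt m2 vD)[].
- by move=> D v F Dt m2 vD /(card_D_fragments Dt m2 vD)[].
Qed.

End Laws.

Lemma filter_eq1 (T : eqType) (P : pred T) (s : seq T) x : uniq s -> x \in s ->
  P x -> {in s, forall y, P y -> y = x} -> [seq y <- s | P y] = [:: x].
Proof.
move=> s_uniq xs Px sP; apply: perm_small_eq => //.
apply: uniq_perm; rewrite ?filter_uniq // => y; rewrite mem_filter inE.
by apply/andP/eqP => [[Py ys]|->]; first exact: sP.
Qed.

(** Uniqueness is asked only of the entries satisfying [P], because all single-vertex fragments have
    the same empty double. *)
Lemma index_nth_filter (K : eqType) (P : pred K) (s : seq K) x0 i :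
  uniq [seq x <- s | P x] -> (i < size s)%N -> P (nth x0 s i) ->
  index (nth x0 s i) s = i.
Proof.
elim: s i => // x s IH [|i] /=; first by rewrite eqxx.
rewrite ltnS => s_uniq si Pi; case: (x =P nth x0 s i) => [xi|_].
  by move: s_uniq; rewrite xi Pi /= mem_filter Pi mem_nth.
by rewrite IH //; move: s_uniq; case: ifP => // _ /andP[].
Qed.

Section CutTreeMap.
Local Open Scope fset_scope.

Definition doubled_label (c : cut_tree) : component := doubled (label c).

(* Every component [C] is replaced by [doubled C]; the split vertex is read off
   the labels of the children. *)
Fixpoint D_tree_of (c : cut_tree) : cut_tree :=
  let: RNode C s := c in
  let v := head [::] [seq v <- comp_branch_points C
                     | map (@label _) s == HW_fragments C v] in
  RNode (doubled C) (if s is [::] then [::] else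
    [seq nth (RNode E [::]) (map D_tree_of s) (index E (map doubled_label s))
    | E <- D_fragments (doubled C) v]).

(** The default of [nth] matters: a removed edge is no doubled label, its index is [size s], and it
    becomes the leaf [RNode E [::]]. *)
Definition D_subtree (s : seq cut_tree) (E : component) : cut_tree :=
  nth (RNode E [::]) (map D_tree_of s) (index E (map doubled_label s)).

Lemma label_D_tree_of c : label (D_tree_of c) = doubled_label c.
Proof. by case: c. Qed.

Lemma D_subtree_notin s E : E \notin map doubled_label s ->
  D_subtree s E = RNode E [::].
Proof. by move=> Es; rewrite /D_subtree nth_default // memNindex ?size_map. Qed.

Lemma label_D_subtree s E : label (D_subtree s E) = E.
Proof.
have [Es|Es] := boolP (E \in map doubled_label s); last by rewrite D_subtree_notin.
have ltis : (index E (map doubled_label s) < size s)%N.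
  by rewrite -(size_map doubled_label) index_mem.
rewrite /D_subtree (nth_map (RNode fset0 [::])) // label_D_tree_of.
by rewrite -(nth_map _ fset0) // nth_index.
Qed.

Lemma D_subtreeE s x : uniq [seq D <- map doubled_label s | D != fset0] ->
  x \in s -> doubled_label x != fset0 ->
  D_subtree s (doubled_label x) = D_tree_of x.
Proof.
move=> s_uniq xs x0.
have ix : (index x s < size s)%N by rewrite index_mem.
have gx : doubled_label x = nth fset0 (map doubled_label s) (index x s).
  by rewrite (nth_map x) // nth_index.
rewrite /D_subtree {2}gx (index_nth_filter s_uniq) ?size_map -?gx //.
by rewrite (nth_map x) // nth_index.
Qed.

(** Distinctness is carried from [D_fragments_uniq] along the permutation: non-empty doubled
    fragments differ from each other and from the removed edges. *)
Lemma split_matching C v (s : seq cut_tree) : tree_like C ->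
  v \in comp_branch_points C -> map (@label _) s = HW_fragments C v ->
  [/\ perm_eq (D_fragments (doubled C) v)
        ([seq [fset w] | w <- children (doubled C) v] ++
         [seq D <- map doubled_label s | D != fset0]),
      uniq [seq D <- map doubled_label s | D != fset0] &
      {in children (doubled C) v, forall w, [fset w] \notin map doubled_label s}].
Proof.
move=> Ct vC sC; have := perm_D_fragments Ct vC; rewrite -sC -map_comp => P.
have := D_fragments_uniq (doubled C) v; rewrite (perm_uniq P) cat_uniq => /and3P[_ N U].
split=> // w wv; apply: contra N => ws; apply/hasP; exists [fset w]; last exact: map_f.
rewrite mem_filter ws andbT; apply/fset0Pn; exists w; by rewrite inE.
Qed.

Variable R : realType.

(** Inversion: by [HW_fragments_inj] the labels single out [v], so the sum over split vertices
    collapses and [D_tree_of] picks the same [v]. *)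
Lemma HW_split_prob_neq0 C s : HW_split_prob (RNode C s) != 0 :> R ->
  ((#|` comp_leaves C| < 2)%N /\ s = [::]) \/
  (~~ (#|` comp_leaves C| < 2)%N /\ exists v,
    [/\ v \in comp_branch_points C, map (@label _) s = HW_fragments C v,
        {in s, forall x, HW_split_prob x != 0 :> R},
        HW_split_prob (RNode C s) = HW_weight C v * \prod_(x <- s) HW_split_prob x :> R &
        D_tree_of (RNode C s) =
          RNode (doubled C) (map (D_subtree s) (D_fragments (doubled C) v))]).
Proof.
rewrite /=; case: ifPn => m2.
  by case: (eqVneq s [::]) => [->|_]; [left|rewrite eqxx].
rewrite mulf_eq0 negb_or => /andP[S0 P0]; right; split=> //.
have [v vC /eqP sv] : exists2 v, v \in comp_branch_points C &
    map (@label _) s == HW_fragments C v.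
  apply/hasP; apply: contraNT S0 => /hasPn H.
  by rewrite big_seq_cond big1 // => v /andP[/H /negbTE ->].
have F : [seq v <- comp_branch_points C | map (@label _) s == HW_fragments C v] = [:: v].
  apply: filter_eq1; rewrite ?fset_uniq ?sv // => w wC /eqP /esym.
  exact: HW_fragments_inj.
exists v; split=> //.
- by move: P0; rewrite big_map prodf_seq_eq0 => /hasPn.
- by rewrite -big_filter F big_seq1 big_map.
- by rewrite F; case: (s) sv.
Qed.

Lemma HW_split_prob_leaf c : tree_like (label c) -> HW_split_prob c != 0 :> R ->
  doubled_label c = fset0 -> c = RNode (label c) [::] /\ HW_split_prob c = 1 :> R.
Proof.
case: c => C s Ct /HW_split_prob_neq0 [[m2 ->] _ /=|[m2 _]]; first by rewrite m2.
rewrite /doubled_label /= => /eqP; rewrite -cardfs_eq0 card_doubled //; lia.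
Qed.

(** For [m] leaves and [m.-1.*2] edges: both fragmentations stop at the same components. *)
Lemma double_pred_lt2 m : (m.-1.*2 < 2)%N = (m < 2)%N.
Proof. by case: m => [|[|m]]. Qed.

Lemma D_split_prob_D_tree_of c : tree_like (label c) -> HW_split_prob c != 0 :> R ->
  D_split_prob (D_tree_of c) = HW_split_prob c :> R.
Proof.
elim/rtree_ind_mem : c => C s IH Ct HW0; have := card_doubled Ct; simpl in Ct.
have m0 := card_comp_leaves Ct; have [[m2 s0]|] := HW_split_prob_neq0 HW0.
  by rewrite s0 /= m2 => ->; rewrite double_pred_lt2 m2.
case=> m2 [v [vC sv sN0 -> ->]] cardE.
have [P U N] := split_matching Ct vC sv.
have st x : x \in s -> tree_like (label x).
  move=> xs; apply: (@tree_like_HW_fragments C v _ Ct); last by rewrite -sv map_f.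
  by move: vC; rewrite mem_branch => /andP[].
rewrite [LHS]/= cardE double_pred_lt2 (negbTE m2).
have -> : map (@label _) (map (D_subtree s) (D_fragments (doubled C) v)) =
    D_fragments (doubled C) v.
  by rewrite -map_comp -[RHS]map_id; apply: eq_map => E /=; rewrite label_D_subtree.
have vE : v \in lower_endpoints (doubled C).
  move: vC; rewrite mem_lower_endpoints ?nil_doubled // mem_branch => /andP[vC v0].
  rewrite degree_doubled //; have [r _ /(_ v vC)[_ _ v1 _]] := Ct; lia.
rewrite -big_filter (@filter_eq1 _ _ _ v) ?fset_uniq //; last first.
  by move=> w wE /eqP /esym; apply: D_fragments_inj; rewrite ?nil_doubled.
rewrite big_seq1; congr (_ * _).
  rewrite /HW_weight -[#|` children (doubled C) v|]/(degree (doubled C) v).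
  rewrite -[#|` children C v|]/(degree C v).
  move: vC; rewrite mem_branch => /andP[vC v0].
  have [r _ /(_ v vC)[_ _ v1 _]] := Ct.
  rewrite degree_doubled // (_ : (_.*2 - 2 = (degree C v).-1.*2)%N); last by lia.
  rewrite -!mul2n !natrM -mulf_div divff ?pnatr_eq0 // mul1r.
  rewrite -!subn1 !natrB ?lt0n //; last by rewrite -lt0n ltnW // ltnNge -ltnS.
(* Both products reduce to the non-empty doubled fragments: removed edges contribute 1 on the left,
   single-vertex fragments contribute 1 on the right. *)
rewrite !big_map (perm_big _ P) big_cat big_map /= big_filter big_map.
rewrite [X in X * _]big1_seq ?mul1r; last first.
  by move=> w /andP[_ /N wN]; rewrite D_subtree_notin //= cardfs1.
rewrite [RHS](bigID (fun x => doubled_label x != fset0)) /=.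
rewrite [X in _ = _ * X]big1_seq ?mulr1; last first.
  move=> x /andP[/negPn/eqP x0 xs]; apply: proj2 (HW_split_prob_leaf (st x xs) (sN0 x xs) x0).
rewrite [LHS]big_seq_cond [RHS]big_seq_cond; apply: eq_bigr => x /andP[xs x0].
by rewrite D_subtreeE //; apply: IH => //; [exact: st|exact: sN0].
Qed.

(** The root labels are assumed equal since [doubled] forgets which single vertex a component is.
    The image reveals the split vertex, hence all labels below; subtrees with an edge are recovered
    by induction, the others are leaves. *)
Lemma D_tree_of_inj (c1 c2 : cut_tree) : tree_like (label c1) -> label c1 = label c2 ->
  HW_split_prob c1 != 0 :> R -> HW_split_prob c2 != 0 :> R ->
  D_tree_of c1 = D_tree_of c2 -> c1 = c2.
Proof.
elim/rtree_ind_mem : c1 c2 => C s IH [C' t] Ct; simpl in Ct; rewrite [label _]/=.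
rewrite [label (RNode C' t)]/= => CC'; subst C'.
move=> /HW_split_prob_neq0 [[m2 ->]|[m2 [v [vC sv s0 _ ->]]]].
  by move=> /HW_split_prob_neq0 [[_ ->]|[]] //; rewrite m2.
move=> /HW_split_prob_neq0 [[m2']|[_ [w [wC tw t0 _ ->]]]]; first by rewrite m2' in m2.
move=> [E]; have vw : v = w.
  have inE' u : u \in comp_branch_points C -> u \in lower_endpoints (doubled C).
    rewrite mem_lower_endpoints ?nil_doubled // mem_branch => /andP[uC u0].
    rewrite degree_doubled //; have [r _ /(_ u uC)[_ _ u1 _]] := Ct; lia.
  apply: (@D_fragments_inj (doubled C)); rewrite ?nil_doubled ?inE' //.
  move/(congr1 (map (@label _))): E; rewrite -!map_comp.
  by rewrite !(@eq_map _ _ (_ \o _) id) ?map_id // => ? /=; rewrite label_D_subtree.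
subst w; congr RNode.
have [P U N] := split_matching Ct vC sv; have [P' U' N'] := split_matching Ct vC tw.
have vC' : v \in C by move: vC; rewrite mem_branch => /andP[].
have st : size s = size t.
  by have := congr1 size (etrans sv (esym tw)); rewrite !size_map.
pose x0 : cut_tree := RNode fset0 [::].
apply: (@eq_from_nth _ x0) => // i si.
set x := nth _ s i; set y := nth _ t i.
have xs : x \in s by exact: mem_nth.
have yt : y \in t by rewrite mem_nth -?st.
have xy : label x = label y.
  have := congr1 (fun l => nth fset0 l i) (etrans sv (esym tw)).
  by rewrite !(nth_map x0) -?st.
have xt : tree_like (label x).
  by apply: (tree_like_HW_fragments Ct vC'); rewrite -sv map_f.
have [x00|xN0] := eqVneq (doubled_label x) fset0.
  have [-> _] := HW_split_prob_leaf xt (s0 x xs) x00.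
  have yt' : tree_like (label y) by rewrite -xy.
  have y00 : doubled_label y = fset0 by rewrite /doubled_label -xy.
  by have [-> _] := HW_split_prob_leaf yt' (t0 y yt) y00; rewrite xy.
apply: IH => //; [exact: s0|exact: t0|].
rewrite -(D_subtreeE U xs xN0) -(D_subtreeE U' yt) /doubled_label -?xy //.
have /eq_in_map := E; apply; rewrite (perm_mem P) mem_cat mem_filter.
by rewrite xN0 (map_f doubled_label xs) orbT.
Qed.

End CutTreeMap.

(** * Comparison of the two cut-trees *)

Section CutTreeEmbedding.
Local Open Scope fset_scope.
Variable R : realType.

Lemma embeds_D_tree_of (c : cut_tree) : tree_like (label c) ->
  HW_split_prob c != 0 :> R -> embeds (D_tree_of c) (cut_HW_of c).
Proof.
elim/rtree_ind_mem : c => C s IH Ct; simpl in Ct.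
move=> /HW_split_prob_neq0 [[m2 ->]|[m2 [v [vC sv s0 _ ->]]]].
  exists id; split=> //= u; rewrite inE => /eqP ->; exists [::] => //.
have [P U N] := split_matching Ct vC sv.
have vC' : v \in C by move: vC; rewrite mem_branch => /andP[].
have st x : x \in s -> tree_like (label x).
  by move=> xs; apply: (tree_like_HW_fragments Ct vC'); rewrite -sv map_f.
set Ds := D_fragments (doubled C) v.
have Ds_uniq : uniq Ds := D_fragments_uniq _ _.
pose x0 : cut_tree := RNode fset0 [::].
pose frs := map doubled_label s.
pose t := map cut_HW_of s ++ nseq (size s - 3) (RNode None [::]).
have st_size : size t = (size s + (size s - 3))%N.
  by rewrite size_cat size_map size_nseq.
(* Matching by label. Removed edges get indices beyond [t], shifted by [i] to keep [m] injective. *)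
pose m i := if nth fset0 Ds i \in frs then index (nth fset0 Ds i) frs
            else (size t + i)%N.
have frs_lt E : E \in frs -> (index E frs < size s)%N.
  by rewrite -index_mem size_map.
have frsDs E : E \in frs -> E != fset0 -> E \in Ds.
  by move=> Efrs E0; rewrite (perm_mem P) mem_cat mem_filter E0 Efrs orbT.
have Dsfrs E : E \in Ds -> E \in frs -> E != fset0.
  rewrite (perm_mem P) mem_cat mem_filter => /orP[/mapP[w wv ->]|/andP[->]//].
  by move=> ws; have := N w wv; rewrite ws.
apply: (@embeds_node _ _ _ _ _ _ x0 (RNode None [::]) m); rewrite size_map.
- move=> i j; rewrite !inE => iD jD; rewrite /m.
  case: ifPn => iF; case: ifPn => jF.
  + move=> ij; apply/eqP; rewrite -(nth_uniq fset0 _ _ Ds_uniq) //; apply/eqP.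
    by rewrite -(nth_index fset0 iF) ij nth_index.
  + by move=> E; have := frs_lt _ iF; rewrite E st_size; lia.
  + by move=> E; have := frs_lt _ jF; rewrite -E st_size; lia.
  + by move/addnI.
- move=> i iD; rewrite (nth_map fset0) // /m; case: ifPn => iF; last first.
    by rewrite ltnNge leq_addr.
  move=> _; have iE := frs_lt _ iF.
  have xs : nth x0 s (index (nth fset0 Ds i) frs) \in s by exact: mem_nth.
  have gx : doubled_label (nth x0 s (index (nth fset0 Ds i) frs)) = nth fset0 Ds i.
    by rewrite -(nth_map _ fset0) // nth_index.
  rewrite nth_cat size_map iE (nth_map x0) // -{1}gx D_subtreeE //.
    by apply: IH => //; [exact: st|exact: s0].
  by rewrite gx Dsfrs // mem_nth.
- move=> i iD; rewrite (nth_map fset0) // /m; case: ifPn => iF.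
    by have := frs_lt _ iF; rewrite st_size; lia.
  by move=> _; rewrite D_subtree_notin.
- move=> j; rewrite st_size => jt; rewrite nth_cat size_map; case: ifPn => js; last first.
    by right; rewrite nth_nseq if_same.
  rewrite (nth_map x0) //; set x := nth x0 s j.
  have xs : x \in s by exact: mem_nth.
  have [x00|xN0] := eqVneq (doubled_label x) fset0.
    by right; have [-> _] := HW_split_prob_leaf (st x xs) (s0 x xs) x00.
  left; have xD := frsDs _ (map_f doubled_label xs) xN0.
  exists (index (doubled_label x) Ds); first by rewrite index_mem.
  rewrite /m nth_index // map_f //.
  have gx : doubled_label x = nth fset0 frs j by rewrite (nth_map x0).
  by rewrite gx (index_nth_filter U) ?size_map // -gx.
Qed.

End CutTreeEmbedding.

(** * The coupling *)

Section PlanarTrees.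
Local Open Scope nat_scope.
Implicit Types (t : tree) (v : addr).

Fixpoint nb_children t v : nat :=
  let: RNode _ s := t in
  if v is i :: v' then nth (fun=> 0) (map nb_children s) i v' else size s.

Lemma nb_children_cons s i v :
  nb_children (tnode s) (i :: v) = nb_children (nth (tnode [::]) s i) v.
Proof.
rewrite /=; have [si|si] := ltnP i (size s); first by rewrite (nth_map (tnode [::])).
by rewrite !nth_default ?size_map //; case: v => //= j v; rewrite nth_nil.
Qed.

Lemma rcons_vertices t v i :
  (rcons v i \in vertices t) = (v \in vertices t) && (i < nb_children t v).
Proof.
elim: v t => [|j v IH] [[] s].
  by rewrite mem_vertices_cons !root_in_vertices andbT.
by rewrite rcons_cons !mem_vertices_cons nb_children_cons IH andbA.
Qed.

(** Added leaves come last among their siblings, so old vertices keep their addresses; having no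
    offspring, the new ones are never parents. *)
Lemma rcons_vertices_add_leaves t v i :
  (rcons v i \in vertices (add_leaves t)) =
  (v \in vertices t) && (i < nb_children t v + (nb_children t v - 2)).
Proof.
elim: v t => [|j v IH] [[] s]; rewrite /add_leaves -/add_leaves.
  rewrite mem_vertices_cons !root_in_vertices andbT /=.
  by rewrite size_cat size_map size_nseq.
rewrite rcons_cons !mem_vertices_cons nb_children_cons size_cat size_map size_nseq.
rewrite nth_cat size_map; have [sj|sj] := ltnP j (size s).
  rewrite (nth_map (tnode [::])) // IH ltn_addr //.
rewrite nth_nseq if_same /= [RHS]/=; case: (v) => [|k w]; rewrite ?inE ?andbF //=.
Qed.

Lemma vertices_vertex_set t v : (v \in vertex_set t) = (v \in vertices t).
Proof. by rewrite !inE. Qed.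

Lemma degree_vertex_set t v : v \in vertices t ->
  degree (vertex_set t) v = nb_children t v.
Proof.
by move=> vt; apply: degreeE => i; rewrite vertices_vertex_set rcons_vertices vt.
Qed.

Lemma tree_like_vertex_set t : (forall v, v \in vertices t -> nb_children t v != 1) ->
  tree_like (vertex_set t).
Proof.
move=> t1; exists [::]; first by rewrite vertices_vertex_set root_in_vertices.
move=> v; rewrite vertices_vertex_set => vt; rewrite degree_vertex_set //; split.
- exact: prefix0s.
- case/lastP: v vt => // v i; rewrite rcons_vertices => /andP[vt _] _.
  by exists v; rewrite ?vertices_vertex_set ?child_of_rcons.
- exact: t1.
- by move=> i; rewrite vertices_vertex_set rcons_vertices vt.
Qed.

(** With truncated subtraction [k + (k - 2)] equals [k.*2 - 2] for every k except 1; here the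
    assumption on [nu] enters. *)
Lemma edge_set_add_leaves t : (forall v, v \in vertices t -> nb_children t v != 1) ->
  edge_set (add_leaves t) = doubled (vertex_set t).
Proof.
move=> t1; apply: doubledP => [|v i]; first by rewrite !inE eqxx.
rewrite /edge_set in_fsetD1 !vertices_vertex_set rcons_vertices_add_leaves.
have -> : rcons v i != [::] by case: v.
case: (boolP (v \in vertices t)) => //= vt; rewrite degree_vertex_set //.
have := t1 v vt; lia.
Qed.

Lemma gw_prob_neq0 (R : realType) (nu : probability nat R) t v :
  nu [set 1%N] = 0%E -> gw_prob nu t != 0%R -> v \in vertices t ->
  nb_children t v != 1.
Proof.
move=> nu1; elim: v t => [|j v IH] [[] s];
  rewrite [gw_prob _ _]/= mulf_eq0 negb_or => /andP[ns].
  by move=> _ _; apply: contraNneq ns => /= ->; rewrite nu1.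
rewrite big_map prodf_seq_eq0 => /hasPn P.
rewrite mem_vertices_cons nb_children_cons => /andP[sj]; apply: IH.
by apply: (P (nth _ s j)); exact: mem_nth.
Qed.

End PlanarTrees.

(** * Transport of the laws along [D_tree_of] *)

Section Coupling.
Context {R : realType}.
Local Open Scope ereal_scope.

(* Since both families have total mass 1, the values of [a] exhaust [b]. *)
Lemma esum_fiber (T1 T2 : choiceType) (a : T1 -> R) (b : T2 -> R) (f : T1 -> T2) c :
  (forall x, 0 <= a x)%R -> (forall y, 0 <= b y)%R ->
  \esum_(x in [set: T1]) (a x)%:E = 1 -> \esum_(y in [set: T2]) (b y)%:E = 1 ->
  (forall x, a x != 0%R -> b (f x) = a x) ->
  (forall x y, a x != 0%R -> a y != 0%R -> f x = f y -> x = y) ->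
  \esum_(x in [set x | f x = c]) (a x)%:E = (b c)%:E.
Proof.
move=> a0 b0 a1 b1 ab f_inj.
have [[x ax fx]|noc] := pselect (exists2 x, a x != 0%R & f x = c).
  rewrite (esumID [set x]); last by move=> y _; rewrite lee_fin.
  rewrite (_ : _ `&` [set x] = [set x]); last by apply/seteqP; split=> y [] // ->.
  rewrite esum_set1 ?lee_fin // esum1; first by rewrite adde0 -(ab x ax) fx.
  move=> y [/= fy yx].
  by congr EFin; apply/eqP; apply/negPn/negP => ay; apply: yx; apply: f_inj; rewrite ?fx.
rewrite esum1; last first.
  move=> x /= fx; congr EFin; apply/eqP/negPn/negP => ax; apply: noc.
  by exists x.
pose S := [set x | a x != 0%R].
have S1 : \esum_(y in f @` S) (b y)%:E = 1.
  rewrite esum_image; last by move=> x y; rewrite !inE => ? ?; exact: f_inj.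
  rewrite -[RHS]a1 [RHS](esumID S) ?setTI; last by move=> x _; rewrite lee_fin.
  rewrite [X in _ = _ + X]esum1 ?adde0; last first.
    by move=> x /negP/negPn/eqP ->.
  by apply: eq_esum => x /ab ->.
move: b1; rewrite (esumID (f @` S)) ?setTI; last by move=> y _; rewrite lee_fin.
rewrite S1 => /(congr1 (fun x => x - 1)); rewrite addeAC subee // add0e => S0.
apply/eqP; rewrite eq_le lee_fin b0 -S0 /=; apply/(@esum_ge_term _ _ _ (fun y => (b y)%:E)).
  by move=> y; rewrite lee_fin.
by move=> [x Sx fx]; apply: noc; exists x.
Qed.

Variables (nu : probability nat R) (n : nat).
Hypothesis nu1 : nu [set 1%N] = 0.
Hypothesis gw_n : 0 < gw_nleaves_prob nu n.

Local Notation q := (gw_cond_prob nu n).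

(** [gw_cond_prob] divides by [fine] of this sum, which would be 0 at [+oo]. *)
Lemma gw_nleaves_prob_fin : gw_nleaves_prob nu n \is a fin_num.
Proof.
rewrite ge0_fin_numE ?(ltW gw_n) //; apply: (@le_lt_trans _ _ 1); last exact: ltry.
apply: le_trans (esum_gw_prob nu).
rewrite [leRHS](esumID [set t | nleaves t = n]) ?setTI; last first.
  by move=> t _; rewrite lee_fin gw_prob_ge0.
by rewrite leeDl // esum_ge0 // => t _; rewrite lee_fin gw_prob_ge0.
Qed.

Lemma gw_cond_prob_ge0 t : (0 <= q t)%R.
Proof.
by rewrite /gw_cond_prob; case: ifP => // _; rewrite divr_ge0 ?gw_prob_ge0 // fine_ge0 // ltW.
Qed.

Lemma esum_gw_cond_prob : \esum_(t in [set: tree]) (q t)%:E = 1.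
Proof.
pose z := fine (gw_nleaves_prob nu n).
have z0 : (0 < z)%R by rewrite -lte_fin fineK ?gw_nleaves_prob_fin.
transitivity (z^-1%:E * gw_nleaves_prob nu n); last first.
  by rewrite -(fineK gw_nleaves_prob_fin) -EFinM mulVf ?gt_eqF.
rewrite -ge0_esumZl; last 2 first.
- by rewrite lee_fin invr_ge0 ltW.
- by move=> t; rewrite lee_fin gw_prob_ge0.
rewrite [RHS]esum_mkcond; apply: eq_esum => t _; rewrite /gw_cond_prob.
rewrite (_ : (t \in _) = (nleaves t == n)); last by apply/idP/eqP; rewrite inE.
by case: ifP => // _; rewrite mulrC EFinM.
Qed.

Lemma gw_cond_tree_like t : q t != 0%R ->
  tree_like (vertex_set t) /\ edge_set (add_leaves t) = doubled (vertex_set t).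
Proof.
rewrite /gw_cond_prob; case: ifP => [_|]; last by rewrite eqxx.
rewrite mulf_eq0 negb_or => /andP[t0 _].
have t1 v : v \in vertices t -> nb_children t v != 1%N := gw_prob_neq0 nu1 t0.
by split; [exact: tree_like_vertex_set|exact: edge_set_add_leaves].
Qed.

Lemma cut_HW0_prob_ge0 t c : (0 <= cut_HW0_prob t c :> R)%R.
Proof. by rewrite /cut_HW0_prob; case: ifP => // _; exact: HW_split_prob_ge0. Qed.

Lemma cut_D_prob_ge0 t c : (0 <= cut_D_prob t c :> R)%R.
Proof. by rewrite /cut_D_prob; case: ifP => // _; exact: D_split_prob_ge0. Qed.

Lemma esum_cut_HW0_prob t : tree_like (vertex_set t) ->
  \esum_(c in [set: cut_tree]) (cut_HW0_prob t c : R)%:E = 1.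
Proof.
move=> tt; rewrite -(esum_HW_split_prob tt) [RHS]esum_mkcond; apply: eq_esum => c _.
rewrite /cut_HW0_prob (_ : (c \in _) = (label c == vertex_set t)); first by case: ifP.
by apply/idP/eqP; rewrite inE.
Qed.

Lemma esum_cut_D_prob t :
  \esum_(c in [set: cut_tree]) (cut_D_prob t c : R)%:E = 1.
Proof.
have tE : [::] \notin edge_set t by rewrite !inE eqxx.
rewrite -(esum_D_split_prob tE) [RHS]esum_mkcond; apply: eq_esum => c _.
rewrite /cut_D_prob (_ : (c \in _) = (label c == edge_set t)); first by case: ifP.
by apply/idP/eqP; rewrite inE.
Qed.

Lemma cut_HW0_prob_neq0 t c : cut_HW0_prob t c != 0%R :> R ->
  label c = vertex_set t /\ cut_HW0_prob t c = HW_split_prob c :> R.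
Proof. by rewrite /cut_HW0_prob; case: (label c =P _) => [lc|_]; [|rewrite eqxx]. Qed.

Lemma esum_cut_HW0_fiber t c : q t != 0%R ->
  \esum_(w in [set w | D_tree_of w = c]) (cut_HW0_prob t w : R)%:E =
  (cut_D_prob (add_leaves t) c)%:E.
Proof.
move=> /gw_cond_tree_like[tt tE]; apply: esum_fiber.
- exact: cut_HW0_prob_ge0.
- exact: cut_D_prob_ge0.
- exact: esum_cut_HW0_prob.
- exact: esum_cut_D_prob.
- move=> w w0; have [lw wE] := cut_HW0_prob_neq0 w0; rewrite wE in w0 *.
  rewrite /cut_D_prob label_D_tree_of tE /doubled_label lw eqxx.
  by apply: D_split_prob_D_tree_of; rewrite ?lw.
- move=> w w' w0 w'0; have [lw wE] := cut_HW0_prob_neq0 w0.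
  have [lw' wE'] := cut_HW0_prob_neq0 w'0; rewrite wE in w0; rewrite wE' in w'0.
  by apply: D_tree_of_inj w0 w'0; rewrite ?lw.
Qed.

Local Notation p := (gw_cut_prob nu n (@cut_HW0_prob R)).

Let term_ge0 t c : 0 <= (q t * cut_HW0_prob t c)%:E.
Proof. by rewrite lee_fin mulr_ge0 ?gw_cond_prob_ge0 ?cut_HW0_prob_ge0. Qed.

Lemma gw_cut_HW0_prob_ge0 c : 0 <= p c.
Proof. by apply: esum_ge0. Qed.

Lemma esum_gw_cut_HW0_prob : \esum_(c in [set: cut_tree]) p c = 1.
Proof.
rewrite /gw_cut_prob esum_exchange // -[RHS]esum_gw_cond_prob.
apply: eq_esum => t _.
under eq_esum do rewrite EFinM.
rewrite ge0_esumZl ?lee_fin ?gw_cond_prob_ge0 //; last first.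
  by move=> c; rewrite lee_fin cut_HW0_prob_ge0.
have [->|/gw_cond_tree_like[tt _]] := eqVneq (q t) 0%R; first by rewrite mul0e.
by rewrite esum_cut_HW0_prob // mule1.
Qed.

(** [D_tree_of] does not depend on [t], so the identity for each fixed [t] can be averaged over the
    conditioned Galton-Watson law. *)
Lemma esum_gw_cut_HW0_fiber c : \esum_(w in [set w | D_tree_of w = c]) p w =
  gw_cut_prob nu n (fun t => cut_D_prob (add_leaves t)) c.
Proof.
rewrite /gw_cut_prob esum_exchange //; apply: eq_esum => t _.
under eq_esum do rewrite EFinM.
rewrite ge0_esumZl ?lee_fin ?gw_cond_prob_ge0 //; last first.
  by move=> w; rewrite lee_fin cut_HW0_prob_ge0.
have [->|q0] := eqVneq (q t) 0%R; first by rewrite mul0e mul0r.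
by rewrite esum_cut_HW0_fiber // EFinM.
Qed.

Lemma gw_cut_HW0_GH_dist w : p w != 0 ->
  tree_GH_dist (D_tree_of w) (cut_HW_of w) <= 1%:E :> \bar R.
Proof.
move=> pw; apply: embeds_GH_dist.
have [t] : exists t, (q t * cut_HW0_prob t w != 0)%R.
  apply: contrapT => H; move/eqP: pw; apply; apply: esum1 => t _.
  by congr EFin; apply/eqP/negPn/negP => t0; apply: H; exists t.
rewrite mulf_eq0 negb_or => /andP[/gw_cond_tree_like[tt _] w0].
have [lw wE] := cut_HW0_prob_neq0 w0; rewrite wE in w0.
by apply: (@embeds_D_tree_of R); rewrite ?lw.
Qed.

End Coupling.

Lemma GH_dist_leaf (R : realType) (A B : Type) (a : A) (b : B) :
  (tree_GH_dist (RNode a [::]) (RNode b [::]) <= 1%:E :> \bar R)%E.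
Proof.
apply: embeds_GH_dist; exists id; split=> // u; rewrite inE => /eqP ->; by exists [::].
Qed.

Theorem proposition1p4 (R : realType) (nu : probability nat R)
    (nu1 : nu [set 1%N] = 0%E) (n : nat) (n_ge2 : (2 <= n)%N)
    (gw_n : (0 < gw_nleaves_prob nu n)%E) :
  exists (d : measure_display) (Omega : measurableType d)
    (P : probability Omega R) (X Y : {RV P >-> cut_tree}),
    [/\ forall c : cut_tree, distribution P X [set c] =
          gw_cut_prob nu n (fun t => cut_D_prob (add_leaves t)) c,
        forall c : cut_tree, distribution P Y [set c] =
          gw_cut_prob nu n cut_HW0_prob c
      & forall w : Omega,
          (tree_GH_dist (X w) (cut_HW_of (Y w)) <= 1%:E :> \bar R)%E].
Proof.
(* The sample space is the set of cut-trees itself, under the law of the vertex fragmentation. *)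
pose P := discrete_law (gw_cut_HW0_prob_ge0 gw_n) (esum_gw_cut_HW0_prob nu1 gw_n).
pose good (w : cut_tree) : Prop :=
  (tree_GH_dist (D_tree_of w) (cut_HW_of w) <= 1%:E :> \bar R)%E.
(* The bound is required at every [w], so null sets are sent to a trivial pair. *)
pose leaf : cut_tree := RNode fset0 [::].
pose X0 (w : cut_tree) : cut_tree := if pselect (good w) then D_tree_of w else leaf.
pose Y0 (w : cut_tree) : cut_tree := if pselect (good w) then w else leaf.
have mX : measurable_fun setT X0 by [].
have mY : measurable_fun setT Y0 by [].
pose X : {RV P >-> cut_tree} := mfun_Sub (mem_set mX).
pose Y : {RV P >-> cut_tree} := mfun_Sub (mem_set mY).
(* Cut-trees that are not [good] have mass 0, so changing a map there does not affect its law. *)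
have lawE (f g : cut_tree -> cut_tree) c : (forall w, good w -> f w = g w) ->
    (P (f @^-1` [set c]) = \esum_(w in [set w | g w = c]) gw_cut_prob nu n cut_HW0_prob w)%E.
  move=> fg; rewrite discrete_lawE esum_mkcond [RHS]esum_mkcond; apply: eq_esum => w _.
  have [->|/(gw_cut_HW0_GH_dist nu1)/fg fw] := eqVneq (gw_cut_prob nu n cut_HW0_prob w) 0%E.
    by rewrite !if_same.
  by congr (if _ then _ else _); apply/idP/idP; rewrite !inE /= fw.
exists _, _, P, X, Y; split=> [c|c|w].
- rewrite -(esum_gw_cut_HW0_fiber nu1 gw_n); apply: lawE => w gw /=.
  by rewrite /X0; case: pselect.
- rewrite -[RHS](@esum_set1 _ _ c) ?gw_cut_HW0_prob_ge0 //.
  by apply: (lawE _ id) => w gw; rewrite /= /Y0; case: pselect.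
- by rewrite /= /X0 /Y0; case: (pselect (good w)) => [gw|?]; [|exact: GH_dist_leaf].
Qed.
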